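(* Let $N\ge 2$ and let $f,g$ be two positive functions on $\mathbb{R}^N$, with $g$ locally integrable and $f$ lower semi-continuous. Assume that $f$ and $g$ are equal and radial, that is, there is a function $h:[0,+\infty)\to(0,\infty)$ such that $f(x)=g(x)=h(|x|)$ for all $x\in\mathbb{R}^N$, where $r\mapsto h(r)$ is log-convex (i.e. $\log h$ is convex) and strictly decreasing for $r\in(0,R_0)$, for some $R_0>0$. Then there exists a number $d_0>0$, which depends only on $R_0$, such that for any $d\in(0,d_0]$, balls centered at the origin with measure $d$ are not isoperimetric for (that is, do not solve) the problem $$\text{Find}\quad \inf\Big\{P_f(M):\ M\text{ has locally finite perimeter and }|M|_g=d\Big\}.$$
   Context: For any measurable set $M\subset\mathbb{R}^N$, the weighted measure and perimeter are $|M|_g=\int_M g(x)\,dx$ (this is the measure of a set referred to in the claim) and $P_f(M)=\int_{\partial M}f(x)\,\mathcal{H}_{N-1}(dx)$, where $\partial M$ denotes the essential boundary of $M$ and $\mathcal{H}_{N-1}$ is $(N-1)$-dimensional Hausdorff measure.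
   Formalization: The number d_0 is allowed to depend on N, R_0 and the values of h on [0,R_0), not on R_0 only: replacing h by ch rescales ball measures, and some admissible h have isoperimetric centered balls, so no d_0 depending only on R_0 exists. *)

(* Defs.v *)
From HB Require Import structures.
From mathcomp Require Import all_boot all_order all_algebra.
From mathcomp Require Import all_classical all_reals all_analysis.
Set Implicit Arguments.
Unset Strict Implicit.
Unset Printing Implicit Defensive.
Import Order.TTheory GRing.Theory Num.Theory.
Import numFieldNormedType.Exports.
Local Open Scope classical_set_scope.
Local Open Scope ring_scope.

(* R^N is 'rV[R]_N. The library norm on matrices is the sup norm, so the
   Euclidean norm is introduced separately; both induce the topology of
   'rV[R]_N. *)
Definition enorm {R : realType} {n : nat} (x : 'rV[R]_n) : R :=
  Num.sqrt (\sum_(i < n) x 0 i ^+ 2).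

Definition eball {R : realType} {n : nat} (x : 'rV[R]_n) (r : R) :
    set 'rV[R]_n :=
  [set y | enorm (y - x) < r].

(* A copy of 'rV[R]_n on which every set is measurable: [mu_ext] on it is the
   outer measure obtained from countable coverings by arbitrary sets. *)
Definition coverable (R : realType) (n : nat) : Type := 'rV[R]_n.
HB.instance Definition _ (R : realType) (n : nat) :=
  Pointed.on (coverable R n).
HB.instance Definition _ (R : realType) (n : nat) :=
  @isMeasurable.Build default_measure_display (coverable R n)
    [set: set (coverable R n)] I (fun _ _ => I) (fun _ _ => I).

Section lebesgue.
Context (R : realType) (n : nat).
Local Open Scope ereal_scope.

(* Volume of the smallest closed box containing a nonempty set A, and +oo if A
   is unbounded; covering by arbitrary sets with this gauge amounts to covering
   by boxes. *)
Definition box_gauge (A : set (coverable R n)) : \bar R :=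
  if A == set0 then 0 else
  ereal_inf [set (\prod_(i < n) (ab.2 0%R i - ab.1 0%R i))%R%:E
            | ab in [set ab : 'rV[R]_n * 'rV[R]_n | forall x, A x ->
                forall i, (ab.1 0 i <= x 0 i <= ab.2 0 i)%R]].

Lemma box_gauge0 : box_gauge set0 = 0.
Proof. by rewrite /box_gauge eqxx. Qed.

Lemma box_gauge_ge0 A : 0 <= box_gauge A.
Proof.
rewrite /box_gauge; case: ifPn => [//|/set0P[x Ax]].
apply: le_ereal_inf_tmp => _ [ab /= /(_ _ Ax) abx <-]; rewrite lee_fin.
apply: prodr_ge0 => i _; rewrite subr_ge0.
by have /andP[] := abx i; exact: le_trans.
Qed.

Definition lebesgue_outer (A : set 'rV[R]_n) : \bar R :=
  mu_ext (box_gauge : set (coverable R n) -> \bar R) A.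

HB.instance Definition _ :=
  isOuterMeasure.Build R 'rV[R]_n lebesgue_outer
    (mu_ext0 box_gauge0 box_gauge_ge0) (mu_ext_ge0 box_gauge_ge0)
    (@le_mu_ext _ _ _ box_gauge) (mu_ext_sigma_subadditive box_gauge_ge0).

End lebesgue.

(* R^n with the sigma-algebra of Lebesgue measurable sets, i.e. the sets that
   are Caratheodory measurable for the Lebesgue outer measure. *)
Notation lebesgueType R n := (caratheodory_type (@lebesgue_outer R n)).

Definition leb (R : realType) (n : nat) : set (lebesgueType R n) -> \bar R :=
  @lebesgue_outer R n.
Arguments leb : clear implicits.

HB.instance Definition _ (R : realType) (n : nat) :=
  isMeasure.Build _ _ _ (leb R n)
    (@caratheodory_measure0 _ _ (@lebesgue_outer R n))
    (@caratheodory_measure_ge0 _ _ (@lebesgue_outer R n))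
    (@caratheodory_measure_sigma_additive _ _ (@lebesgue_outer R n)).

Section hausdorff.
Context (R : realType) (n : nat).
Local Open Scope ereal_scope.

Definition diameter (A : set 'rV[R]_n) : \bar R :=
  ereal_sup [set (enorm (x - y))%:E | x in A & y in A].

(* pi ^ (k/2) / Gamma (k/2 + 1), the volume of the unit ball of R^k, through
   its two-step recurrence. *)
Fixpoint unit_ball_volume (k : nat) : R :=
  match k with
  | 0 => 1
  | 1 => 2
  | k'.+2 => 2 * pi / k%:R * unit_ball_volume k'
  end%R.

Lemma unit_ball_volume_ge0 k : (0 <= unit_ball_volume k)%R.
Proof.
suff: (0 <= unit_ball_volume k)%R /\ (0 <= unit_ball_volume k.+1)%R by case.
elim: k => [//|k [IH0 IH1]]; split=> //=.
by rewrite mulr_ge0// divr_ge0// mulr_ge0// pi_ge0.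
Qed.

Lemma diameter_ge0 A : A !=set0 -> 0 <= diameter A.
Proof.
case=> x Ax; apply: le_ereal_sup_tmp; exists (enorm (x - x))%:E.
  by exists x => //; exists x.
by rewrite lee_fin sqrtr_ge0.
Qed.

Definition hausdorff_gauge (k : nat) (delta : R) (A : set (coverable R n)) :
    \bar R :=
  if A == set0 then 0 else
  if diameter A <= delta%:E
  then (unit_ball_volume k / 2 ^+ k)%R%:E * diameter A ^+ k
  else +oo.

Lemma hausdorff_gauge0 k delta : hausdorff_gauge k delta set0 = 0.
Proof. by rewrite /hausdorff_gauge eqxx. Qed.

Lemma hausdorff_gauge_ge0 k delta A : 0 <= hausdorff_gauge k delta A.
Proof.
rewrite /hausdorff_gauge; case: ifPn => [//|/set0P A0]; case: ifPn => // _.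
rewrite mule_ge0//; first by rewrite lee_fin divr_ge0 ?unit_ball_volume_ge0.
by elim: k => [|k IH]; rewrite ?expe0 ?expeS// mule_ge0// diameter_ge0.
Qed.

Definition hausdorff_premeasure (k : nat) (delta : R) (A : set 'rV[R]_n) :
    \bar R :=
  mu_ext (hausdorff_gauge k delta : set (coverable R n) -> \bar R) A.

Definition hausdorff (k : nat) (A : set 'rV[R]_n) : \bar R :=
  ereal_sup [set hausdorff_premeasure k delta A
            | delta in [set delta : R | (0 < delta)%R]].

Lemma hausdorff_premeasure_le k delta A :
  (0 < delta)%R -> hausdorff_premeasure k delta A <= hausdorff k A.
Proof. by move=> d0; apply: ereal_sup_ubound; exists delta. Qed.

Lemma hausdorff0 k : hausdorff k set0 = 0.
Proof.
apply/eqP; rewrite eq_le; apply/andP; split.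
  apply: ge_ereal_sup => _ [delta _ <-].
  rewrite /hausdorff_premeasure mu_ext0//.
    exact: hausdorff_gauge0.
  exact: hausdorff_gauge_ge0.
apply: le_trans (hausdorff_premeasure_le _ _ ltr01).
exact/mu_ext_ge0/hausdorff_gauge_ge0.
Qed.

Lemma hausdorff_ge0 k A : 0 <= hausdorff k A.
Proof.
apply: le_trans (hausdorff_premeasure_le _ _ ltr01).
exact/mu_ext_ge0/hausdorff_gauge_ge0.
Qed.

Lemma le_hausdorff k : {homo hausdorff k : A B / A `<=` B >-> A <= B}.
Proof.
move=> A B AB; apply: ge_ereal_sup => _ [delta d0 <-].
apply: le_trans (hausdorff_premeasure_le _ _ d0).
exact: le_mu_ext.
Qed.

Lemma hausdorff_sigma_subadditive k : sigma_subadditive (hausdorff k).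
Proof.
move=> F; apply: ge_ereal_sup => _ [delta d0 <-].
apply: le_trans (mu_ext_sigma_subadditive (@hausdorff_gauge_ge0 k delta) F) _.
apply: lee_nneseries => i *; last exact: hausdorff_premeasure_le.
exact/mu_ext_ge0/hausdorff_gauge_ge0.
Qed.

HB.instance Definition _ (k : nat) :=
  isOuterMeasure.Build R 'rV[R]_n (hausdorff k)
    (hausdorff0 k) (hausdorff_ge0 k) (@le_hausdorff k)
    (@hausdorff_sigma_subadditive k).

End hausdorff.

Notation hausdorffType R n k := (caratheodory_type (@hausdorff R n k)).

Definition haus (R : realType) (n k : nat) :
    set (hausdorffType R n k) -> \bar R :=
  @hausdorff R n k.
Arguments haus : clear implicits.

HB.instance Definition _ (R : realType) (n k : nat) :=
  isMeasure.Build _ _ _ (haus R n k)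
    (@caratheodory_measure0 _ _ (@hausdorff R n k))
    (@caratheodory_measure_ge0 _ _ (@hausdorff R n k))
    (@caratheodory_measure_sigma_additive _ _ (@hausdorff R n k)).

Section isoperimetry.
Context {R : realType} {N : nat}.
Implicit Types (M K : set 'rV[R]_N) (f g : 'rV[R]_N -> R).

Definition locally_integrable_on_RN g : Prop :=
  measurable_fun [set: lebesgueType R N] (g : lebesgueType R N -> R) /\
  forall K, compact K -> (\int[leb R N]_(x in K) `|g x|%:E < +oo)%E.

Definition has_density (t : R) M (x : 'rV[R]_N) : Prop :=
  fine (leb R N (M `&` eball x r)) / fine (leb R N (eball x r)) @[r --> 0^'+]
    --> t.

Definition essential_boundary M : set 'rV[R]_N :=
  [set x | ~ has_density 0 M x /\ ~ has_density 1 M x].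

Definition unit_vector (i : 'I_N) : 'rV[R]_N := delta_mx 0 i.

Definition C1 (phi : 'rV[R]_N -> 'rV[R]_N) : Prop :=
  forall i, (forall x, derivable phi x (unit_vector i)) /\
            continuous (fun x => 'D_(unit_vector i) phi x).

Definition divergence (phi : 'rV[R]_N -> 'rV[R]_N) (x : 'rV[R]_N) : R :=
  \sum_(i < N) ('D_(unit_vector i) phi x) 0 i.

(* De Giorgi: the distributional gradient of the indicator function of M has
   finite total variation on every compact set. *)
Definition locally_finite_perimeter M : Prop :=
  forall K, compact K -> exists C : R,
    forall phi, C1 phi -> (forall x, enorm (phi x) <= 1) ->
      (forall x, ~ K x -> phi x = 0) ->
      (\int[leb R N]_(x in M) (divergence phi x)%:E <= C%:E)%E.

Definition weighted_measure g M : \bar R :=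
  (\int[leb R N]_(x in M) (g x)%:E)%E.

Definition weighted_perimeter f M : \bar R :=
  (\int[haus R N N.-1]_(x in essential_boundary M) (f x)%:E)%E.

Definition competitor g (d : R) M : Prop :=
  [/\ (measurable : set (set (lebesgueType R N))) M,
      locally_finite_perimeter M &
      weighted_measure g M = d%:E].

Definition isoperimetric f g (d : R) M : Prop :=
  competitor g d M /\
  forall M', competitor g d M' ->
    (weighted_perimeter f M <= weighted_perimeter f M')%E.

End isoperimetry.

(* Main.v *)
Require Import Defs.
From mathcomp Require Import all_boot all_order all_algebra.
From mathcomp Require Import all_classical all_reals all_analysis.
From mathcomp Require Import measurable_realfun ring lra.
Import Order.TTheory GRing.Theory Num.Theory.
Import numFieldNormedType.Exports.
Local Open Scope classical_set_scope.
Local Open Scope ring_scope.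

(** A small ball pays less perimeter for its measure where the weight is small.
With weight constantly equal to [a], a ball of measure [d] has perimeter
proportional to [a ^ (1/N) d ^ ((N-1)/N)].  Here [h] is strictly smaller away
from the origin than at it, so, for small [d], a ball of measure [d] centred
at a point of norm [c = R0/2] has smaller weighted perimeter than the ball
centred at the origin.

Quantitatively, write [omega] for the volume of the unit ball and [sigma] for
the [N-1]-dimensional Hausdorff measure of the unit sphere.  Let [B_r(0)] and
[B_s(x0)], [|x0| = c], [s <= rho], both have measure [d], and put
[a = c - rho], [b = c + rho].  Then
[h(b) omega s^N <= d <= h(0) omega r^N], while the perimeters are
[h(r) sigma r^(N-1)] and at most [h(a) sigma s^(N-1)].  If the ball at the
origin were optimal, eliminating [r] and [s] would give
[h(r)^N h(b)^(N-1) <= h(a)^N h(0)^(N-1)].  Convexity of [log h] at [a]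
between [0] and [b] bounds [log h(a) - log h(b)] by a multiple of [rho] times
[log h(0) - log h(a)]; hence some [rho], proportional to [R0/N], makes this
inequality false for [h(r)] close to [h(0)], and lower semicontinuity at the
origin makes [h(r)] close to [h(0)] for small [r] ([profile_gap],
[centered_eball_not_isoperimetric]).

The rest of the proof establishes the measure theory of balls and spheres.
A dilation of ratio [t] multiplies Lebesgue outer measure by [t^N] and
Hausdorff measure of dimension [k] by [t^k], so everything reduces to
[0 < omega < +oo] and [0 < sigma < +oo].  Positivity of [omega] follows from
the existence of a ball of positive weighted measure.  Finiteness of [sigma] comes from a packing
argument: many separated points on the sphere carry disjoint small balls in a
thin shell, whose volume is known ([hausdorff_unit_sphere_fin]).  Positivity
of [sigma] comes from coning: a covering of the sphere by small sets yields a
covering of the ball by small boxes ([hausdorff_unit_sphere_gt0]).  The sphere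
is Hausdorff measurable by the metric outer measure criterion
([measurable_lipschitz_sublevel]) and is exactly the essential boundary of its
ball ([essential_boundary_eball]).  Balls have locally finite perimeter because
the integral over a ball of a difference quotient of a function bounded by [1]
is controlled by the volume of a thin shell
([locally_finite_perimeter_eball]).  Finally, the measure of a ball depends
continuously on its radius, so an off-centre ball of measure exactly [d] exists
([exists_eball_weighted_measure]). *)

(** * The Euclidean norm *)

Section euclidean_norm.
Context {R : realType} {n : nat}.
Implicit Types x y z : 'rV[R]_n.

Lemma enorm_ge0 x : 0 <= enorm x.
Proof. exact: sqrtr_ge0. Qed.

Lemma sqr_enorm x : enorm x ^+ 2 = \sum_(i < n) x 0 i ^+ 2.
Proof. by rewrite sqr_sqrtr// sumr_ge0// => i _; rewrite sqr_ge0. Qed.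

Lemma enormZ a x : enorm (a *: x) = `|a| * enorm x.
Proof.
rewrite -sqrtr_sqr /enorm -sqrtrM ?sqr_ge0//; congr Num.sqrt.
by rewrite mulr_sumr; apply: eq_bigr => i _; rewrite mxE exprMn.
Qed.

Lemma enormN x : enorm (- x) = enorm x.
Proof. by rewrite -scaleN1r enormZ normrN1 mul1r. Qed.

Lemma enorm0 : enorm (0 : 'rV[R]_n) = 0.
Proof. by rewrite -(scale0r 0) enormZ normr0 mul0r. Qed.

Lemma enormB x y : enorm (x - y) = enorm (y - x).
Proof. by rewrite -enormN opprB. Qed.

Lemma normr_coord_le_enorm x i : `|x 0 i| <= enorm x.
Proof.
rewrite -sqrtr_sqr ler_wsqrtr// (bigD1 i)//= lerDl sumr_ge0// => j _.
exact: sqr_ge0.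
Qed.

(** With [a] and [b] the two norms, expanding
[0 <= \sum_i (b x_i - a y_i) ^ 2] gives [a b \sum_i x_i y_i <= (a b) ^ 2]. *)
Lemma cauchy_schwarz_sum x y : \sum_(i < n) x 0 i * y 0 i <= enorm x * enorm y.
Proof.
set a := enorm x; set b := enorm y; set s := \sum_(i < n) _.
have a0 : 0 <= a := enorm_ge0 x.
have b0 : 0 <= b := enorm_ge0 y.
have H : 0 <= \sum_(i < n) (b * x 0 i - a * y 0 i) ^+ 2.
  by apply: sumr_ge0 => i _; rewrite sqr_ge0.
have E : \sum_(i < n) (b * x 0 i - a * y 0 i) ^+ 2 =
    b ^+ 2 * a ^+ 2 + a ^+ 2 * b ^+ 2 - 2 * (a * b) * s.
  rewrite [X in _ * X + _ - _](sqr_enorm x) [X in _ + _ * X - _](sqr_enorm y).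
  rewrite !mulr_sumr -big_split/= -sumrB; apply: eq_bigr => i _; ring.
rewrite {}E in H.
have [ab0|ab0] := ltP 0 (a * b); first by nra.
have ab : a * b = 0 by apply/eqP; rewrite eq_le ab0 mulr_ge0.
rewrite ab /s big1// => i _.
move/eqP: ab; rewrite mulf_eq0 => /orP[|] /eqP e.
- have := normr_coord_le_enorm x i; rewrite -/a e normr_le0 => /eqP ->.
  by rewrite mul0r.
- have := normr_coord_le_enorm y i; rewrite -/b e normr_le0 => /eqP ->.
  by rewrite mulr0.
Qed.

Lemma ler_enormD x y : enorm (x + y) <= enorm x + enorm y.
Proof.
rewrite -(@ler_pXn2r _ 2)// ?nnegrE ?addr_ge0 ?enorm_ge0//.
rewrite sqrrD !sqr_enorm mulr2n.
have -> : \sum_(i < n) (x + y) 0 i ^+ 2 = \sum_(i < n) x 0 i ^+ 2 +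
   (\sum_(i < n) x 0 i * y 0 i + \sum_(i < n) x 0 i * y 0 i) +
   \sum_(i < n) y 0 i ^+ 2.
  by rewrite -!big_split; apply: eq_bigr => i _; rewrite mxE/=; ring.
by rewrite lerD2r lerD2l lerD// cauchy_schwarz_sum.
Qed.

Lemma ler_enorm_dist x y z : enorm (x - z) <= enorm (x - y) + enorm (y - z).
Proof. by apply: le_trans (ler_enormD _ _); rewrite addrA subrK. Qed.

Lemma ler_dist_enorm x y : `|enorm x - enorm y| <= enorm (x - y).
Proof.
rewrite ler_norml; have := ler_enormD (x - y) y; have := ler_enormD (y - x) x.
rewrite !subrK (enormB y x); lra.
Qed.

Lemma enorm_eq0 x : enorm x = 0 -> x = 0.
Proof.
move=> x0; apply/rowP => i; rewrite mxE; apply/eqP.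
by rewrite -normr_le0 -x0 normr_coord_le_enorm.
Qed.

Lemma enorm_unit_vector (i : 'I_n) :
  enorm (unit_vector i : 'rV[R]_n) = 1.
Proof.
rewrite /enorm (bigD1 i)//= big1 ?addr0; first by rewrite mxE !eqxx expr1n sqrtr1.
by move=> j ji; rewrite mxE eqxx/= (negbTE ji) expr0n.
Qed.

End euclidean_norm.

(** * Outer measures generated by gauges *)

Section outer_measures_from_gauges.
Local Open Scope ereal_scope.
Context {R : realType} {n : nat}.
Variable mu : set (coverable R n) -> \bar R.
Hypothesis mu_ge0 : forall A, 0 <= mu A.

(** Coverings of [X] are carried by [T] to coverings of [T X], so a bound of
[nu] by the gauge on single sets extends to the generated outer measure.  It
serves for dilations and for the cone over a subset of the sphere. *)
Lemma le_mu_ext_transport {U : Type} (nu : set U -> \bar R)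
    (T : set (coverable R n) -> set U) (c : R) :
  (0 < c)%R -> (forall A, 0 <= nu A) -> sigma_subadditive nu ->
  {homo nu : A B / A `<=` B >-> A <= B} ->
  (forall X (F : nat -> set _), X `<=` \bigcup_k F k -> T X `<=` \bigcup_k T (F k)) ->
  (forall E, nu (T E) <= c%:E * mu E) ->
  forall X, nu (T X) <= c%:E * mu_ext mu X.
Proof.
move=> c0 nu0 nusub nule TU nuT X; rewrite -lee_pdivrMl//.
apply: le_ereal_inf_tmp => _ [F [_ XF] <-]; rewrite lee_pdivrMl//.
apply: le_trans (nule _ _ (TU _ _ XF)) _; apply: le_trans (nusub _) _.
rewrite -nneseriesZl; last by move=> *; exact: mu_ge0.
by apply: lee_nneseries => *; [exact: nu0|exact: nuT].
Qed.

(** Cutting every member of a covering along [P] and [Q].  For [Q] the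
complement of [P] this is Caratheodory measurability of [P]; for [P] and [Q]
far apart it is additivity on separated sets. *)
Lemma le_mu_ext_split (P Q : set (coverable R n)) :
  (forall E, mu (E `&` P) + mu (E `&` Q) <= mu E) ->
  forall X, mu_ext mu (X `&` P) + mu_ext mu (X `&` Q) <= mu_ext mu X.
Proof.
move=> muPQ X; apply: le_ereal_inf_tmp => _ [F [_ XF] <-].
have cov A : mu_ext mu (X `&` A) <= \sum_(k <oo) mu (F k `&` A).
  apply: ereal_inf_lbound; exists (fun k => F k `&` A) => //; split => //.
  by move=> x [/XF[k _ Fkx] Ax]; exists k.
apply: le_trans (leeD (cov P) (cov Q)) _.
rewrite -nneseriesD//.
by apply: lee_nneseries => // k _; rewrite adde_ge0.
Qed.

End outer_measures_from_gauges.

Lemma mu_ext_le_gauge {R : realType} {n : nat} (mu : set (coverable R n) -> \bar R) :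
  mu set0 = 0%E -> (forall A, 0 <= mu A)%E -> forall A, (mu_ext mu A <= mu A)%E.
Proof.
move=> mu0 mu_ge0 A; apply: ereal_inf_lbound.
exists (fun k => if k == 0%N then A else set0).
  by split => // x Ax; exists 0%N.
rewrite (nneseries_recl (f := fun k => mu (if k == 0%N then A else set0)))//.
by rewrite eseries0 ?adde0// => -[|k].
Qed.

(** * Lebesgue measurable sets *)

Lemma measurable_sublevel {d : measure_display} {T : measurableType d}
    {R : realType} (f : T -> R) (c : R) :
  measurable_fun [set: T] f -> measurable [set x | f x < c].
Proof.
move=> mf; rewrite (_ : [set x | _] = setT `&` f @^-1` `]-oo, c[); first exact: mf.
by rewrite setTI; apply/seteqP; split=> x /=; rewrite in_itv.
Qed.

Section lebesgue_measurability.
Context {R : realType} {n : nat}.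
Local Open Scope ereal_scope.

Lemma box_gauge_le (A : set (coverable R n)) (a b : 'rV[R]_n) :
  A !=set0 -> (forall x, A x -> forall i, (a 0 i <= x 0 i <= b 0 i)%R) ->
  box_gauge A <= (\prod_(i < n) (b 0%R i - a 0%R i))%R%:E.
Proof.
move=> /set0P/negbTE A0 Aab; rewrite /box_gauge A0.
by apply: ereal_inf_lbound; exists (a, b).
Qed.

(** A hyperplane cuts a box into two boxes whose volumes add up; this makes
half-spaces Caratheodory measurable. *)
Lemma box_gauge_split (i : 'I_n) (c : R) (A : set (coverable R n)) :
  box_gauge (A `&` [set x : coverable R n | (x 0 i <= c)%R]) +
  box_gauge (A `&` ~` [set x : coverable R n | (x 0 i <= c)%R]) <= box_gauge A.
Proof.
set H := [set x | _].
rewrite {3}/box_gauge; case: ifPn => [/eqP ->|A0].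
  by rewrite !set0I box_gauge0 adde0.
apply: le_ereal_inf_tmp => _ [[a b] /= Aab <-].
have gle (B : set (coverable R n)) : B `<=` A ->
    box_gauge B <= (\prod_(i < n) (b 0%R i - a 0%R i))%R%:E.
  move=> BA; have [->|/set0P B0] := eqVneq B set0.
    rewrite box_gauge0 lee_fin; have /set0P[x /Aab Ax] := A0.
    apply: prodr_ge0 => j _; rewrite subr_ge0.
    by have /andP[] := Ax j; exact: le_trans.
  by apply: box_gauge_le => // x /BA /Aab.
have [->|/set0P B1] := eqVneq (A `&` H) set0.
  by rewrite box_gauge0 add0e; exact: gle.
have [->|/set0P B2] := eqVneq (A `&` ~` H) set0.
  by rewrite box_gauge0 adde0; exact: gle.
(* Both halves are nonempty, so [c] lies between the [i]-th bounds of the box. *)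
pose b' := (\row_j (if j == i then c else b 0 j))%R : 'rV[R]_n.
pose a' := (\row_j (if j == i then c else a 0 j))%R : 'rV[R]_n.
have g1 : box_gauge (A `&` H) <= (\prod_(i < n) (b' 0%R i - a 0%R i))%R%:E.
  apply: box_gauge_le => // x [Ax Hx] j; rewrite /b' mxE.
  by case: eqP => [->|_]; [rewrite Hx andbT; have /andP[] := Aab _ Ax i|exact: Aab].
have g2 : box_gauge (A `&` ~` H) <= (\prod_(i < n) (b 0%R i - a' 0%R i))%R%:E.
  apply: box_gauge_le => // x [Ax /negP]; rewrite -ltNge => Hx j; rewrite /a' mxE.
  by case: eqP => [->|_]; [rewrite ltW//=; have /andP[] := Aab _ Ax i|exact: Aab].
apply: le_trans (leeD g1 g2) _; rewrite -EFinD lee_fin.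
rewrite (bigD1 i)//= [X in (_ + X)%R](bigD1 i)//= [X in (_ <= X)%R](bigD1 i)//=.
rewrite !mxE eqxx; set p := (\prod_(j < n | j != i) (b 0 j - a 0 j))%R.
have -> : (\prod_(j < n | j != i) (b' 0 j - a 0 j) = p)%R.
  by apply: eq_bigr => j /negbTE ji; rewrite mxE ji.
have -> : (\prod_(j < n | j != i) (b 0 j - a' 0 j) = p)%R.
  by apply: eq_bigr => j /negbTE ji; rewrite mxE ji.
by rewrite -mulrDl addrC subrKA.
Qed.

Lemma measurable_halfspace (i : 'I_n) (c : R) :
  measurable ([set x : lebesgueType R n | (x 0 i <= c)%R]).
Proof.
apply: le_caratheodory_measurable => X.
by apply: le_mu_ext_split; [exact: box_gauge_ge0|exact: box_gauge_split].
Qed.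

Lemma measurable_coord (i : 'I_n) :
  measurable_fun [set: lebesgueType R n] (fun x : lebesgueType R n => x 0%R i : R).
Proof.
apply: (measurability _ (RGenOInfty.measurableE R)) => // _ [_ [c ->] <-].
rewrite setTI (_ : _ @^-1` _ = ~` [set x : lebesgueType R n | (x 0 i <= c)%R]).
  by apply: measurableC; exact: measurable_halfspace.
by apply/seteqP; split=> x /=; rewrite in_itv/= andbT ltNge => /negP.
Qed.

Lemma measurable_enormB (p : 'rV[R]_n) :
  measurable_fun [set: lebesgueType R n]
    (fun x : lebesgueType R n => enorm ((x : 'rV[R]_n) - p)).
Proof.
have msqrt : measurable_fun [set: R] (@Num.sqrt R).
  by apply: continuous_measurable_fun; exact: sqrt_continuous.
apply: (measurableT_comp msqrt
  (g := fun x : lebesgueType R n => \sum_(i < n) ((x : 'rV[R]_n) - p)%R 0%R i ^+ 2)%R).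
apply: measurable_sum => i; apply: measurable_funX.
under eq_fun do rewrite !mxE.
by apply: measurable_funB; [exact: measurable_coord|exact: measurable_cst].
Qed.

Lemma measurable_eball (p : 'rV[R]_n) (r : R) :
  measurable (eball p r : set (lebesgueType R n)).
Proof. exact: measurable_sublevel (measurable_enormB p). Qed.

(** An open set is the union of the countably many rational boxes that it
contains. *)
Lemma measurable_open (U : set 'rV[R]_n) :
  open U -> measurable (U : set (lebesgueType R n)).
Proof.
move=> oU.
pose box (qk : 'rV[rat]_n * nat) : set (lebesgueType R n) :=
  [set x | forall i, (`|x 0 i - ratr (qk.1 0 i)| < qk.2.+1%:R^-1)%R].
pose F qk := if `[< box qk `<=` U >] then box qk else set0.
have mbox qk : measurable (box qk).
  rewrite (_ : box qk = \bigcap_(i in [set: 'I_n])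
      [set x : lebesgueType R n | (`|x 0 i - ratr (qk.1 0 i)| < qk.2.+1%:R^-1)%R]).
    apply: fin_bigcap_measurable => // i _; apply: measurable_sublevel.
    exact: measurableT_comp (@normr_measurable R setT)
      (measurable_funB (measurable_coord i) (measurable_cst _)).
  by apply/seteqP; split=> x /= Hx i; [move=> _|]; exact: Hx.
rewrite (_ : U = \bigcup_qk F qk).
  apply: countable_bigcupT_measurable => // qk.
  by rewrite /F; case: ifP.
apply/seteqP; split=> [x Ux|x [qk _]]; last first.
  by rewrite /F; case: ifPn => [/asboolP|_ //]; exact.
have := open_nbhs_nbhs (conj oU Ux) => /nbhs_ballP[e /= e0 eU].
have [k ke] : exists k, (k.+1%:R^-1 + k.+1%:R^-1 < e)%R.
  have [k hk] := ltr_add_invr (y := 0) (x := (e/2)%R) (divr_gt0 e0 (ltr0Sn _ 1)).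
  by exists k; move: hk; rewrite add0r => hk; rewrite (splitr e) ltrD.
have hq i : exists q : rat, (`|x 0 i - ratr q| < k.+1%:R^-1)%R.
  have /rat_in_itvoo[q] : (x 0 i < x 0 i + k.+1%:R^-1)%R.
    by rewrite ltrDl invr_gt0.
  rewrite in_itv/= => /andP[q1 q2]; exists q.
  by rewrite ltr_distl ltrBlDr q2/= (lt_trans q1)// ltrDl invr_gt0.
pose q := (\row_i projT1 (cid (hq i)))%R.
have bxq : box (q, k) x by move=> i /=; rewrite mxE; case: cid.
exists (q, k) => //; rewrite /F asboolT// => y /= yq; apply: eU; split => // i j.
rewrite (ord1 i) /ball/=; apply: lt_trans ke.
rewrite -(subrKA (ratr (q 0 j)))%R. apply: le_lt_trans (ler_normD _ _) _.
by apply: ltrD; [exact: bxq|rewrite distrC; exact: yq].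
Qed.

Lemma continuous_measurable_leb (f : 'rV[R]_n -> R) :
  continuous f -> measurable_fun [set: lebesgueType R n] (f : lebesgueType R n -> R).
Proof.
move=> cf; apply: (measurability _ (RGenOpens.measurableE R)) => //.
move=> _ [_ [a [b ->]] <-]; rewrite setTI; apply: measurable_open.
apply: open_comp; last exact: interval_open.
by move=> x _; exact: cf.
Qed.

End lebesgue_measurability.

(** * Dilations and the volume of balls *)

Section affine_maps.
Context {R : realType} {n : nat}.
Implicit Types (p x y : 'rV[R]_n) (t r : R) (A : set 'rV[R]_n).

Definition dilation p t : 'rV[R]_n -> 'rV[R]_n := fun y => p + t *: y.

Lemma dilationK p t : t != 0 -> cancel (dilation p t) (dilation (- (t^-1 *: p)) t^-1).
Proof.
by move=> t0 y; rewrite /dilation scalerDr scalerA mulVf// scale1r addKr.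
Qed.

Lemma image_dilationK p t A : t != 0 ->
  dilation (- (t^-1 *: p)) t^-1 @` (dilation p t @` A) = A.
Proof.
move=> t0; rewrite image_comp (_ : _ \o _ = id) ?image_id//.
by apply/funext => y /=; rewrite dilationK.
Qed.

Lemma enorm_dilation p t x y :
  enorm (dilation p t x - dilation p t y) = `|t| * enorm (x - y).
Proof. by rewrite /dilation opprD addrACA subrr add0r -scalerBr enormZ. Qed.

Lemma eball_dilation p r : 0 < r -> eball p r = dilation p r @` eball 0 1.
Proof.
move=> r0; have rn0 : r != 0 by rewrite gt_eqF.
apply/seteqP; split=> [x|_ [y yb <-]] /=; rewrite /eball/=.
- move=> xr; exists (r^-1 *: (x - p)).
    rewrite subr0 enormZ gtr0_norm ?invr_gt0// mulrC ltr_pdivrMr//.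
    by rewrite mul1r.
  by rewrite /dilation scalerA divff// scale1r addrC subrK.
- rewrite /dilation addrAC subrr add0r enormZ gtr0_norm// gtr_pMr//.
  by move: yb; rewrite /eball/= subr0.
Qed.

Local Open Scope ereal_scope.

Lemma box_gauge_dilation p t (A : set (coverable R n)) : (0 < t)%R ->
  box_gauge (dilation p t @` A) <= (t ^+ n)%:E * box_gauge A.
Proof.
move=> t0; have [->|A0] := eqVneq A set0.
  by rewrite image_set0 box_gauge0 mule0.
rewrite -lee_pdivrMl ?exprn_gt0// [leRHS]/box_gauge (negbTE A0).
apply: le_ereal_inf_tmp => _ [[a b] /= Aab <-]; rewrite lee_pdivrMl ?exprn_gt0//.
have /set0P[x Ax] := A0.
apply: (le_trans (@box_gauge_le _ _ _ (dilation p t a) (dilation p t b) _ _)).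
- by exists (dilation p t x); exists x.
- move=> _ [y Ay <-] i; rewrite !mxE !lerD2l !ler_pM2l//; exact: Aab.
rewrite -EFinM lee_fin -[n in (t ^+ n)%R]card_ord -prodr_const -big_split/=.
rewrite le_eqVlt; apply/orP; left; apply/eqP; apply: eq_bigr => i _.
by rewrite !mxE; ring.
Qed.

(** One inequality holds for all dilations; applied to the inverse dilation it
gives the other. *)
Lemma lebesgue_outer_dilation p t A : (0 < t)%R ->
  lebesgue_outer (dilation p t @` A) = (t ^+ n)%:E * lebesgue_outer A.
Proof.
have le q s B : (0 < s)%R ->
    lebesgue_outer (dilation q s @` B) <= (s ^+ n)%:E * lebesgue_outer B.
  move=> s0; apply: (@le_mu_ext_transport R n (@box_gauge R n) _ _
    (@lebesgue_outer R n) (fun B => dilation q s @` B)).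
  - exact: box_gauge_ge0.
  - exact: exprn_gt0.
  - exact: outer_measure_ge0.
  - exact: outer_measure_sigma_subadditive.
  - exact: le_outer_measure.
  - by move=> X F XF _ [x /XF[k _ Fx] <-]; exists k => //; exists x.
  - move=> E; apply: le_trans (box_gauge_dilation _ _ _ s0).
    by apply: mu_ext_le_gauge; [exact: box_gauge0|exact: box_gauge_ge0].
move=> t0; apply/eqP; rewrite eq_le le//= -lee_pdivlMl ?exprn_gt0// -exprVn.
rewrite -{1}(image_dilationK p t A (lt0r_neq0 t0)).
by apply: le; rewrite invr_gt0.
Qed.

Definition unit_ball_measure : R := fine (leb R n (eball 0 1)).

Lemma leb_unit_ball_fin : leb R n (eball 0 1) < +oo.
Proof.
apply: (@le_lt_trans _ _ (box_gauge (eball 0 1 : set (coverable R n)))).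
  by apply: mu_ext_le_gauge; [exact: box_gauge0|exact: box_gauge_ge0].
apply: (le_lt_trans (@box_gauge_le _ _ _ (const_mx (-1)%R) (const_mx 1%R) _ _)).
- by exists 0%R; rewrite /eball/= subr0 enorm0.
- move=> x; rewrite /eball/= subr0 => x1 i; rewrite !mxE -ler_norml.
  by apply: le_trans (ltW x1); exact: normr_coord_le_enorm.
- by rewrite ltry.
Qed.

Lemma unit_ball_measure_ge0 : (0 <= unit_ball_measure)%R.
Proof. by apply: fine_ge0; exact: measure_ge0. Qed.

Lemma leb_eball p r : (0 < r)%R ->
  leb R n (eball p r) = (unit_ball_measure * r ^+ n)%:E.
Proof.
move=> r0; rewrite eball_dilation//.
have -> : leb R n (dilation p r @` eball 0 1) = (r ^+ n)%:E * leb R n (eball 0 1).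
  exact: lebesgue_outer_dilation.
rewrite mulrC EFinM fineK// ge0_fin_numE; first exact: leb_unit_ball_fin.
exact: measure_ge0.
Qed.

Lemma measurable_dilation p t (A : set 'rV[R]_n) : (0 < t)%R ->
  measurable (A : set (lebesgueType R n)) ->
  measurable (dilation p t @` A : set (lebesgueType R n)).
Proof.
move=> t0 mA; apply: le_caratheodory_measurable => X.
have tn0 := lt0r_neq0 t0.
pose Y := dilation (- (t^-1 *: p)) t^-1 @` X.
have XY : X = dilation p t @` Y.
  rewrite /Y -[in LHS](image_dilationK (- (t^-1 *: p)) t^-1 X (invr_neq0 tn0)).
  by rewrite invrK scalerN scalerA divff// scale1r opprK.
clearbody Y; have inj : injective (dilation p t) by exact: can_inj (dilationK p t tn0).
have E1 : X `&` dilation p t @` A = dilation p t @` (Y `&` A).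
  rewrite XY; apply/seteqP; split=> [x [[y Yy <-] [z Az /inj zy]]|_ [y [Yy Ay] <-]].
    by subst z; exists y.
  by split; exists y.
have E2 : X `&` ~` (dilation p t @` A) = dilation p t @` (Y `&` ~` A).
  rewrite XY; apply/seteqP; split=> [x [[y Yy <-] nA]|_ [y [Yy Ay] <-]].
    by exists y => //; split => // Ay; apply: nA; exists y.
  by split; [exists y|move=> [z Az /inj zy]; subst z].
have mAY : lebesgue_outer Y = lebesgue_outer (Y `&` A) + lebesgue_outer (Y `&` ~` A).
  exact: mA Y.
suff : lebesgue_outer (dilation p t @` (Y `&` A)) +
    lebesgue_outer (dilation p t @` (Y `&` ~` A)) <=
    lebesgue_outer (dilation p t @` Y) by rewrite -XY -E1 -E2.
rewrite !lebesgue_outer_dilation// mAY muleDr// ge0_adde_def// inE.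
  exact: outer_measure_ge0.
exact: outer_measure_ge0.
Qed.

Lemma measurable_fun_dilation p t : (0 < t)%R ->
  measurable_fun [set: lebesgueType R n] (dilation p t : lebesgueType R n -> lebesgueType R n).
Proof.
move=> t0 _ A mA; rewrite setTI; have tn0 := lt0r_neq0 t0.
rewrite (_ : _ @^-1` _ = dilation (- (t^-1 *: p)) t^-1 @` A).
  by apply: measurable_dilation => //; rewrite invr_gt0.
apply/seteqP; split=> [x /= Ax|_ [x Ax <-] /=].
  by exists (dilation p t x) => //; rewrite dilationK.
have := dilationK (- (t^-1 *: p)) t^-1 (invr_neq0 tn0) x.
by rewrite invrK scalerN scalerA divff// scale1r opprK => ->.
Qed.

End affine_maps.

(** * Hausdorff measure: dilations and measurability *)

Section hausdorff_gauge_theory.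
Context {R : realType} {n : nat} (k : nat).
Implicit Types (A B X : set 'rV[R]_n) (t d delta : R) (p : 'rV[R]_n).

Definition hausdorff_const : R := unit_ball_volume R k / 2 ^+ k.

Lemma hausdorff_const_gt0 : 0 < hausdorff_const.
Proof.
rewrite divr_gt0 ?exprn_gt0//.
suff: 0 < unit_ball_volume R k /\ 0 < unit_ball_volume R k.+1 by case.
elim: k => [//|j [IH0 IH1]]; split=> //=.
by rewrite mulr_gt0// divr_gt0// mulr_gt0// pi_gt0.
Qed.

Local Open Scope ereal_scope.

Lemma diameter_le A d : (forall x y, A x -> A y -> (enorm (x - y) <= d)%R) ->
  diameter A <= d%:E.
Proof.
by move=> Ad; apply: ge_ereal_sup => _ [x Ax [y Ay <-]]; rewrite lee_fin Ad.
Qed.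

Lemma hausdorff_gauge_le delta A d : (0 <= d <= delta)%R ->
  (forall x y, A x -> A y -> (enorm (x - y) <= d)%R) ->
  hausdorff_gauge k delta A <= (hausdorff_const * d ^+ k)%:E.
Proof.
move=> /andP[d0 dd] Ad; rewrite /hausdorff_gauge; case: ifPn => [_|/set0P A0].
  by rewrite lee_fin mulr_ge0 ?exprn_ge0// ltW// hausdorff_const_gt0.
have dA := diameter_le _ _ Ad.
rewrite (le_trans dA) ?lee_fin//= -/hausdorff_const (EFinM hausdorff_const) lee_pmul2l//; last first.
  by rewrite lte_fin hausdorff_const_gt0.
have := diameter_ge0 A0; move: dA; case: (diameter A) => [e| |]//.
by rewrite !lee_fin => ed e0; rewrite -EFin_expe lee_fin lerXn2r ?nnegrE.
Qed.

(** Replaces the extended real diameter by a real number, so that later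
estimates are about real numbers only. *)
Lemma hausdorff_gaugeP delta A : A !=set0 ->
  hausdorff_gauge k delta A = +oo \/
  exists d, [/\ (0 <= d <= delta)%R,
    forall x y, A x -> A y -> (enorm (x - y) <= d)%R &
    hausdorff_gauge k delta A = (hausdorff_const * d ^+ k)%:E].
Proof.
move=> A0; rewrite /hausdorff_gauge; case: ifPn => [/eqP A00|_].
  by case: A0 => x; rewrite A00.
case: ifPn => [|_]; last by left.
have dge := diameter_ge0 A0.
have dub x y : A x -> A y -> (enorm (x - y))%:E <= diameter A.
  by move=> Ax Ay; apply: ereal_sup_ubound; exists x => //; exists y.
case: (diameter A) dge dub => [e| |]// e0 dub ed; right; exists e; split.
- by move: e0 ed; rewrite !lee_fin => -> ->.
- by move=> x y Ax Ay; rewrite -lee_fin dub.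
- by rewrite (EFinM hausdorff_const) EFin_expe.
Qed.

Lemma hausdorff_gauge_mono delta A B : A `<=` B ->
  hausdorff_gauge k delta A <= hausdorff_gauge k delta B.
Proof.
move=> AB; have [->|/set0P[x Ax]] := eqVneq A set0.
  by rewrite hausdorff_gauge0 hausdorff_gauge_ge0.
have /(hausdorff_gaugeP delta)[->|[d [d0 Bd ->]]] : B !=set0.
  by exists x; exact: AB.
  exact: leey.
by apply: hausdorff_gauge_le => // y z Ay Az; apply: Bd; exact: AB.
Qed.

Lemma hausdorff_gauge_anti delta delta' A : (delta <= delta')%R ->
  hausdorff_gauge k delta' A <= hausdorff_gauge k delta A.
Proof.
move=> dd; have [->|/set0P] := eqVneq A set0.
  by rewrite hausdorff_gauge0 hausdorff_gauge_ge0.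
move=> /(hausdorff_gaugeP delta)[->|[d [/andP[d0 d1] Ad ->]]]; first exact: leey.
by apply: hausdorff_gauge_le => //; rewrite d0/= (le_trans d1).
Qed.

Lemma hausdorff_premeasure_anti delta delta' A : (delta <= delta')%R ->
  hausdorff_premeasure k delta' A <= hausdorff_premeasure k delta A.
Proof.
move=> dd; apply: le_ereal_inf_tmp => _ [F FA <-].
apply: le_trans (_ : \sum_(j <oo) hausdorff_gauge k delta' (F j) <= _).
  by apply: ereal_inf_lbound; exists F.
apply: lee_nneseries => *; first exact: hausdorff_gauge_ge0.
exact: hausdorff_gauge_anti.
Qed.

Lemma hausdorff_gauge_dilation p t delta A : (0 < t)%R ->
  hausdorff_gauge k (t * delta)%R (dilation p t @` A) <=
  (t ^+ k)%:E * hausdorff_gauge k delta A.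
Proof.
move=> t0; have [->|/set0P] := eqVneq A set0.
  by rewrite image_set0 !hausdorff_gauge0 mule0.
move=> /(hausdorff_gaugeP delta)[->|[d [/andP[d0 d1] Ad ->]]].
  by rewrite gt0_muley ?lte_fin ?exprn_gt0// leey.
rewrite -EFinM mulrCA -exprMn; apply: hausdorff_gauge_le.
  by rewrite mulr_ge0 ?(ltW t0)//= ler_pM2l.
move=> _ _ [x Ax <-] [y Ay <-].
by rewrite enorm_dilation gtr0_norm// ler_pM2l//; exact: Ad.
Qed.

Lemma hausdorff_dilation p t A : (0 < t)%R ->
  hausdorff k (dilation p t @` A) = (t ^+ k)%:E * hausdorff k A.
Proof.
have le q s B : (0 < s)%R ->
    hausdorff k (dilation q s @` B) <= (s ^+ k)%:E * hausdorff k B.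
  move=> s0; apply: ge_ereal_sup => _ [delta /= delta0 <-].
  have ds0 : (0 < delta / s)%R by rewrite divr_gt0.
  apply: le_trans (_ : (s ^+ k)%:E * hausdorff_premeasure k (delta / s)%R B <= _).
    apply: (@le_mu_ext_transport R n (hausdorff_gauge k (delta / s)) _ _
      (hausdorff_premeasure k delta) (fun B => dilation q s @` B)).
    - exact: hausdorff_gauge_ge0.
    - exact: exprn_gt0.
    - by move=> C; exact/mu_ext_ge0/hausdorff_gauge_ge0.
    - exact: (mu_ext_sigma_subadditive (@hausdorff_gauge_ge0 R n k delta)).
    - by move=> C D CD; exact: le_mu_ext.
    - by move=> X F XF _ [x /XF[j _ Fx] <-]; exists j => //; exists x.
    - move=> E; apply: le_trans (hausdorff_gauge_dilation q _ _ _ s0).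
      rewrite mulrC divfK ?gt_eqF//.
      apply: mu_ext_le_gauge; first exact: hausdorff_gauge0.
      exact: hausdorff_gauge_ge0.
  rewrite lee_pmul2l ?lte_fin ?exprn_gt0//; exact: hausdorff_premeasure_le.
move=> t0; apply/eqP; rewrite eq_le le//= -lee_pdivlMl ?exprn_gt0// -exprVn.
rewrite -{1}(image_dilationK p t A (lt0r_neq0 t0)).
by apply: le; rewrite invr_gt0.
Qed.

(** A set of diameter less than [eta] cannot meet both [A] and [B], so for small
[delta] every admissible covering of the union splits. *)
Lemma hausdorff_separated A B (eta : R) : (0 < eta)%R ->
  (forall x y, A x -> B y -> (eta <= enorm (x - y))%R) ->
  hausdorff k A + hausdorff k B <= hausdorff k (A `|` B).
Proof.
move=> eta0 AB.
have [->|Hfin] := eqVneq (hausdorff k (A `|` B)) +oo; first exact: leey.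
have split delta : (0 < delta < eta)%R ->
    hausdorff_premeasure k delta A + hausdorff_premeasure k delta B <=
    hausdorff_premeasure k delta (A `|` B).
  move=> /andP[d0 de].
  have := @le_mu_ext_split R n (hausdorff_gauge k delta)
    (@hausdorff_gauge_ge0 _ _ k delta) A B _ (A `|` B).
  rewrite setUK setUC setUK setUC; apply => E.
  have [->|/set0P[x [Ex Ax]]] := eqVneq (E `&` A) set0.
    by rewrite hausdorff_gauge0 add0e; exact: hausdorff_gauge_mono.
  have [->|/set0P[y [Ey By]]] := eqVneq (E `&` B) set0.
    by rewrite hausdorff_gauge0 adde0; exact: hausdorff_gauge_mono.
  have /(hausdorff_gaugeP delta)[->|[d [/andP[_ d1] Ed _]]] : E !=set0.
  - by exists x.
  - exact: leey.
  - have := AB _ _ Ax By; rewrite leNgt => /negP; case.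
    by rewrite (le_lt_trans _ de)// (le_trans (Ed _ _ Ex Ey)).
have sum d1 d2 : (0 < d1)%R -> (0 < d2)%R ->
    hausdorff_premeasure k d1 A + hausdorff_premeasure k d2 B <=
    hausdorff k (A `|` B).
  move=> d10 d20; pose d := Num.min (Num.min d1 d2) (eta / 2)%R.
  have d0 : (0 < d)%R by rewrite !lt_min d10 d20 divr_gt0.
  apply: le_trans (leeD _ _) (le_trans (split d _) _).
  - by apply: hausdorff_premeasure_anti; rewrite !ge_min lexx.
  - by apply: hausdorff_premeasure_anti; rewrite !ge_min lexx orbT.
  - rewrite d0/= !gt_min; apply/orP; right.
    by rewrite ltr_pdivrMr// ltr_pMr// ltr1n.
  - exact: hausdorff_premeasure_le.
have fin C : C `<=` A `|` B -> hausdorff k C \is a fin_num.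
  move=> CAB; rewrite ge0_fin_numE ?hausdorff_ge0//.
  apply: le_lt_trans (@le_hausdorff R n k _ _ CAB) _.
  by rewrite ltey.
have finp C d : C `<=` A `|` B -> (0 < d)%R ->
    hausdorff_premeasure k d C \is a fin_num.
  move=> CAB d0; rewrite ge0_fin_numE.
    apply: le_lt_trans (hausdorff_premeasure_le k C d0) _.
    by rewrite -ge0_fin_numE ?hausdorff_ge0// fin.
  exact/mu_ext_ge0/hausdorff_gauge_ge0.
have sA : A `<=` A `|` B by left.
have sB : B `<=` A `|` B by right.
rewrite -leeBrDr ?fin//; apply: ge_ereal_sup => _ [d1 /= d10 <-].
rewrite leeBrDr ?fin// addeC -leeBrDr ?finp//.
apply: ge_ereal_sup => _ [d2 /= d20 <-].
by rewrite leeBrDr ?finp// addeC; exact: sum.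
Qed.

End hausdorff_gauge_theory.

(** The sublevel sets of a [1]-Lipschitz function are Hausdorff measurable: this
is Caratheodory's criterion for metric outer measures.  The part of [X] above
level [c] is exhausted by [Y j], at positive distance from the sublevel set.
The layers [D j] between consecutive levels have summable measures, because
layers whose indices have the same parity are separated from each other; hence
what [Y j] omits has measure tending to [0]. *)
Section hausdorff_measurability.
Context {R : realType} {n : nat} (k : nat).
Variable phi : 'rV[R]_n -> R.
Hypothesis phi_lip : forall x y, `|phi x - phi y| <= enorm (x - y).
Local Open Scope ereal_scope.

Let haus_sep (A B : set 'rV[R]_n) (a b : R) : (a < b)%R ->
  (forall x, A x -> (phi x <= a)%R) -> (forall x, B x -> (b <= phi x)%R) ->
  hausdorff k A + hausdorff k B <= hausdorff k (A `|` B).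
Proof.
move=> ab Aa Bb; apply: (@hausdorff_separated _ _ _ _ _ (b - a)%R).
  by rewrite subr_gt0.
move=> x y /Aa xa /Bb yb; apply: le_trans (phi_lip _ _).
by rewrite distrC; apply: le_trans (ler_norm _); exact: lerB.
Qed.

Lemma measurable_lipschitz_sublevel (c : R) :
  measurable ([set x | (phi x <= c)%R] : set (hausdorffType R n k)).
Proof.
apply: le_caratheodory_measurable => X; set H := [set x | _].
suff : hausdorff k (X `&` H) + hausdorff k (X `&` ~` H) <= hausdorff k X by [].
have [->|Xfin] := eqVneq (hausdorff k X) +oo; first exact: leey.
have {}Xfin : hausdorff k X < +oo by rewrite ltey.
pose s j : R := (j.+1%:R^-1)%R.
have s_gt0 j : (0 < s j)%R by rewrite invr_gt0.
have s_dec i j : (i < j)%N -> (s j < s i)%R.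
  by move=> ij; rewrite ltf_pV2 ?posrE// ltr_nat.
pose D j : set 'rV[R]_n := X `&` [set x | (c + s j.+1 < phi x <= c + s j)%R].
pose Y j : set 'rV[R]_n := X `&` [set x | (c + s j < phi x)%R].
(* [e] is the parity of the layers that are summed. *)
have sumD e m : \sum_(0 <= j < m) hausdorff k (D (j.*2 + e)%N) <= hausdorff k X.
  suff : \sum_(0 <= j < m) hausdorff k (D (j.*2 + e)%N) <=
      hausdorff k (\big[setU/set0]_(0 <= j < m) D (j.*2 + e)%N).
    move=> /le_trans; apply; apply: (le_outer_measure (hausdorff k)).
    by rewrite big_mkord -(bigcup_mkord _ (fun j => D (j.*2 + e)%N)) => x [i _ []].
  elim: m => [|[_|m IH]]; first by rewrite !big_geq// hausdorff_ge0.
    by rewrite !big_nat1.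
  rewrite big_nat_recr//= [X in _ <= hausdorff k X]big_nat_recr//=.
  apply: le_trans (leeD2r _ IH) _; rewrite addeC setUC.
  apply: (haus_sep _ _ (c + s (m.+1.*2 + e)%N)%R (c + s (m.*2 + e).+1)%R).
  - by rewrite ltrD2l s_dec// doubleS !addSn.
  - by move=> x [_ /andP[]].
  - move=> x; rewrite big_mkord -(bigcup_mkord _ (fun j => D (j.*2 + e)%N)) => -[j /= jm [_ /= /andP[+ _]]].
    move=> /ltW; apply: le_trans; rewrite lerD2l lef_pV2 ?posrE// ler_nat.
    by rewrite !ltnS leq_add2r leq_double.
have fin : \sum_(j <oo) hausdorff k (D j.*2 `|` D j.*2.+1) < +oo.
  apply: (@le_lt_trans _ _ (hausdorff k X + hausdorff k X)).
    apply: lime_le; first by apply: is_cvg_nneseries => *; exact: hausdorff_ge0.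
    apply: nearW => m; apply: le_trans (leeD (sumD 0%N m) (sumD 1%N m)).
    rewrite -big_split/=; apply: lee_sum => j _.
    rewrite addn0 addn1; exact: (outer_measureU2 (hausdorff k)).
  by rewrite lte_add_pinfty.
have tail := nneseries_tail_cvg fin (fun _ _ => @hausdorff_ge0 _ _ _ _).
have cvg_bound : (hausdorff k X +
    \sum_(m <= j <oo) hausdorff k (D j.*2 `|` D j.*2.+1)) @[m --> \oo] -->
    hausdorff k X + 0.
  by apply: cvgeD tail; [rewrite fin_num_adde_defl|exact: cvg_cst].
rewrite -[leRHS]adde0; apply: cvge_ge cvg_bound; apply: nearW => m.
have cov : X `&` ~` H `<=` Y m.*2 `|`
    \bigcup_(j in ~` `I_m) (D j.*2 `|` D j.*2.+1).
  move=> x [Xx /= /negP]; rewrite -ltNge => cx.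
  have [cY|cY] := ltP (c + s m.*2)%R (phi x); [by left|right].
  have ex : exists j, (c + s j.+1 < phi x)%R.
    have [j hj] := ltr_add_invr cx; exists j; apply: lt_trans hj.
    by rewrite ltrD2l s_dec.
  have [j sj jmin] := ex_minnP ex.
  have mj : (m.*2 <= j)%N.
    rewrite leqNgt; apply/negP => jm; move: sj; rewrite ltNge => /negP; apply.
    apply: le_trans cY _; rewrite lerD2l lef_pV2 ?posrE// ler_nat ltnS.
    exact: jm.
  have Dj : D j x.
    split => //=; rewrite sj/= leNgt; apply/negP => sj'.
    case: j mj jmin sj' {sj} => [|j]; last by move=> _ jmin /jmin; rewrite ltnn.
    rewrite leqn0 double_eq0 => /eqP m0 _ /lt_geF.
    by rewrite m0 double0 in cY; rewrite cY.
  exists j./2; first by apply/negP; rewrite -leqNgt geq_half_double.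
  rewrite -(odd_double_half j) in Dj; case: (odd j) Dj; [by right|by left].
have := le_outer_measure (hausdorff k) _ _ cov.
move=> /le_trans /(_ (outer_measureU2 _ _ _)) /= covX.
apply: le_trans (leeD2l _ covX) _; rewrite addeA.
apply: leeD; last exact: (outer_measure_sigma_subadditive_tail (hausdorff k)).
apply: (@le_trans _ _ (hausdorff k ((X `&` H) `|` Y m.*2))).
  apply: (haus_sep _ _ c (c + s m.*2)%R).
  - by rewrite ltrDl.
  - by move=> x [].
  - by move=> x [_ /ltW].
by apply: (le_outer_measure (hausdorff k)); rewrite -setIUr; exact: subIsetl.
Qed.

End hausdorff_measurability.

(** * Shells and spheres *)

Lemma subrX_le {R : realFieldType} (a b L : R) (m : nat) : 0 <= a -> a <= b ->
  b <= L -> b ^+ m.+1 - a ^+ m.+1 <= (b - a) * (m.+1%:R * L ^+ m).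
Proof.
move=> a0 ab bL; rewrite subrXX ler_wpM2l ?subr_ge0//.
rewrite mulr_natl -[m.+1 in X in _ <= X]card_ord -sumr_const.
have b0 := le_trans a0 ab.
apply: ler_sum => -[i /= im] _; rewrite -[in leRHS](subnK (im : (i <= m)%N)) exprD.
have L0 := le_trans b0 bL; have aL := le_trans ab bL.
by apply: ler_pM; rewrite ?exprn_ge0//; apply: lerXn2r.
Qed.

Section annulus.
Context {R : realType} {m : nat}.
Local Notation n := m.+1.
Local Open Scope ereal_scope.

Lemma eball_sub (p : 'rV[R]_n) r s : (r <= s)%R -> eball p r `<=` eball p s.
Proof. by move=> rs x; rewrite /eball/= => /lt_le_trans; apply. Qed.

Lemma leb_annulus_le (p : 'rV[R]_n) r s L : (0 < r)%R -> (r <= s)%R -> (s <= L)%R ->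
  leb R n (eball p s `\` eball p r) <=
  (@unit_ball_measure R n * ((s - r) * (n%:R * L ^+ m)))%:E.
Proof.
move=> r0 rs sL; have s0 := lt_le_trans r0 rs.
have -> : leb R n (eball p s `\` eball p r) =
    leb R n (eball p s) - leb R n (eball p r).
  rewrite -[in RHS](setIidr (eball_sub p _ _ rs)).
  apply: (measureD (mu := leb R n)); [exact: measurable_eball|exact: measurable_eball|].
  by suff : leb R n (eball p s) < +oo by []; rewrite leb_eball// ltry.
rewrite !leb_eball// -EFinB lee_fin -mulrBr.
by rewrite ler_wpM2l ?unit_ball_measure_ge0// subrX_le// ltW.
Qed.

End annulus.

Section unit_sphere.
Context {R : realType} {m : nat}.
Local Notation n := m.+1.
Implicit Types (p x y : 'rV[R]_n) (s : seq 'rV[R]_n) (r e : R).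

Definition esphere p r : set 'rV[R]_n := [set x | enorm (x - p) = r].

Lemma esphere_dilation p r : 0 < r -> esphere p r = dilation p r @` esphere 0 1.
Proof.
move=> r0; have rn0 : r != 0 by rewrite gt_eqF.
apply/seteqP; split=> [x|_ [y yb <-]] /=; rewrite /esphere/=.
- move=> xr; exists (r^-1 *: (x - p)).
    by rewrite /esphere/= subr0 enormZ gtr0_norm ?invr_gt0// xr mulVf.
  by rewrite /dilation scalerA divff// scale1r addrC subrK.
- rewrite /dilation addrAC subrr add0r enormZ gtr0_norm//.
  by move: yb; rewrite /esphere/= subr0 => ->; rewrite mulr1.
Qed.

(** The sphere is the zero set of the [1]-Lipschitz function
[x |-> |enorm (x - p) - r|]. *)
Lemma measurable_esphere k p r :
  measurable (esphere p r : set (hausdorffType R n k)).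
Proof.
rewrite (_ : esphere p r = [set x | `|enorm (x - p) - r| <= 0]).
  apply: measurable_lipschitz_sublevel => x y.
  apply: le_trans (ler_dist_dist _ _) _; rewrite opprB addrA subrK.
  by apply: le_trans (ler_dist_enorm _ _) _; rewrite opprB addrA subrK.
apply/seteqP; split=> x; rewrite /esphere/= normr_le0 subr_eq0; first by move->.
by move/eqP.
Qed.

Lemma hausdorff_esphere k p r : 0 < r ->
  hausdorff k (esphere p r) = ((r ^+ k)%:E * hausdorff k (esphere (0%R : 'rV[R]_n) 1))%E.
Proof. by move=> r0; rewrite esphere_dilation// hausdorff_dilation. Qed.

(** The factor [2] makes the balls of radius [e] around the points disjoint. *)
Definition separated e s := pairwise (fun x y => 2 * e <= enorm (x - y)) s.

Lemma leb_bigsetU_separated e s : 0 < e -> separated e s ->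
  leb R n (\big[setU/set0]_(x <- s) eball x e) =
  ((size s)%:R * (@unit_ball_measure R n * e ^+ n))%:E.
Proof.
move=> e0; elim: s => [_|x s IH /= /andP[xs /IH {}IH]].
  by rewrite big_nil mul0r; exact: (measure0 (leb R n)).
rewrite big_cons.
have mU : measurable (\big[setU/set0]_(x <- s) eball x e : set (lebesgueType R n)).
  by apply: bigsetU_measurable => y _; exact: measurable_eball.
transitivity (leb R n (eball x e) + leb R n (\big[setU/set0]_(x <- s) eball x e))%E.
  apply: (measureU (leb R n)) => //; first exact: measurable_eball.
  rewrite -subset0 => z [xz]; rewrite -bigcup_seq => -[y /= ys yz].
  have := allP xs y ys; rewrite leNgt => /negP; apply.
  apply: le_lt_trans (ler_enorm_dist _ z _) _.
  by rewrite mulrDl mul1r enormB ltrD.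
by rewrite IH leb_eball// -EFinD -natr1 mulrDl mul1r addrC.
Qed.

(** The disjoint balls of radius [e] around the points lie in a shell of
thickness [2 e], of volume at most [2 e n 2 ^ m omega]; dividing by the volume
[omega e ^ n] of each ball bounds their number by a multiple of [e ^- m]. *)
Lemma size_separated_esphere e s : 0 < @unit_ball_measure R n -> 0 < e <= 1 / 2 ->
  separated e s -> (forall x, x \in s -> esphere 0 1 x) ->
  (size s)%:R * e ^+ m <= n%:R * 2 ^+ n.
Proof.
move=> w0 /andP[e0 e1] sep sS.
have sub : \big[setU/set0]_(x <- s) eball x e `<=` eball 0 (1 + e) `\` eball 0 (1 - e).
  rewrite -bigcup_seq => y [x /= /sS xS xy]; move: xS xy; rewrite /esphere/eball/= !subr0.
  move=> x1 xy; split.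
    by rewrite -[y](subrK x) addrC; apply: le_lt_trans (ler_enormD _ _) _; rewrite x1 ltrD2l.
  apply/negP; rewrite -leNgt lerBlDr -x1 enormB in xy *.
  rewrite -[X in enorm X <= _](subrK y) addrC.
  by apply: le_trans (ler_enormD _ _) _; rewrite lerD2l ltW.
have le : (leb R n (\big[setU/set0]_(x <- s) eball x e) <=
    leb R n (eball 0 (1 + e) `\` eball 0 (1 - e)))%E.
  exact: (le_outer_measure (@lebesgue_outer R n)).
rewrite leb_bigsetU_separated// in le.
have := le_trans le (leb_annulus_le 0 (1 - e) (1 + e) 2 _ _ _).
have -> : 1 + e - (1 - e) = 2 * e by ring.
rewrite lee_fin mulrCA ler_pM2l// => H.
rewrite -(ler_pM2l e0); move: H; rewrite !exprS => H.
have := H _ _ _; lra.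
Qed.
(** A separated family of maximal size is a net: a point of the sphere at
distance at least [2 e] from all its members could be added to it. *)
Lemma maximal_separated_esphere e : 0 < @unit_ball_measure R n -> 0 < e <= 1 / 2 ->
  exists s, [/\ separated e s, forall x, x \in s -> esphere 0 1 x &
    esphere 0 1 `<=` \bigcup_(x in [set` s]) eball x (2 * e)].
Proof.
move=> w0 e01; have /andP[e0 _] := e01.
pose good k := exists s, [/\ size s = k, separated e s &
  forall x, x \in s -> esphere 0 1 x].
have ex : exists k, `[< good k >] by exists 0%N; apply/asboolP; exists [::].
pose B := (n%:R * 2 ^+ n) / e ^+ m.
have B0 : 0 <= B by rewrite divr_ge0 ?exprn_ge0// ?mulr_ge0// ltW.
have ub k : `[< good k >] -> (k <= Num.bound B)%N.
  move=> /asboolP[s [<- sep sS]]; rewrite ltnW// -(ltr_nat R).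
  apply: le_lt_trans (archi_boundP B0); rewrite ler_pdivlMr ?exprn_gt0//.
  exact: size_separated_esphere.
have [k /asboolP[s [sk sep sS]] kmax] := ex_maxnP ex ub.
exists s; split => // x Sx; apply: contrapT => nx.
suff : (k.+1 <= k)%N by rewrite ltnn.
apply: kmax; apply/asboolP; exists (x :: s); split => /=.
- by rewrite sk.
- rewrite /separated/= -/(separated e s) sep andbT; apply/allP => y ys.
  by rewrite leNgt; apply/negP => xy; apply: nx; exists y.
- by move=> y; rewrite inE => /predU1P[->//|/sS].
Qed.

(** The balls around a maximal separated family with [e = d / 4] have diameter
at most [d] and their number is of order [d ^- m], so the sums that they
contribute stay bounded as [d] tends to [0]. *)
Lemma hausdorff_unit_sphere_fin : 0 < @unit_ball_measure R n ->
  (hausdorff m (esphere (0%R : 'rV[R]_n) 1) < +oo)%E.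
Proof.
move=> w0; pose C := @hausdorff_const R m * (4 ^+ m * (n%:R * 2 ^+ n)).
apply: (@le_lt_trans _ _ C%:E); last exact: ltry.
have c0 := @hausdorff_const_gt0 R m.
apply: ge_ereal_sup => _ [delta /= d0 <-].
pose d := Num.min delta 1; have d01 : 0 < d <= 1.
  by rewrite lt_min d0 ltr01 ge_min lexx orbT.
have dd : d <= delta by rewrite ge_min lexx.
apply: le_trans (hausdorff_premeasure_anti _ _ _ _ dd) _.
have /andP[{}d0 d1] := d01.
pose e := d / 4; have e0 : 0 < e <= 1 / 2 by rewrite /e; lra.
have [s [sep sS Ss]] := maximal_separated_esphere e w0 e0.
pose F j : set 'rV[R]_n := if (j < size s)%N then eball (nth 0 s j) (2 * e) else set0.
apply: (@le_trans _ _ (\sum_(j <oo) hausdorff_gauge m d (F j))%E).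
  apply: ereal_inf_lbound; exists F => //; split => // x /Ss[y /= ys xy].
  by exists (index y s) => //; rewrite /F index_mem ys nth_index.
rewrite (nneseries_split _ (size s)); last by move=> *; exact: hausdorff_gauge_ge0.
rewrite [X in (_ + X)%E]eseries0 ?adde0; last first.
  by move=> i; rewrite add0n => si _; rewrite /F ltnNge si hausdorff_gauge0.
rewrite add0n; apply: (@le_trans _ _ (\sum_(0 <= j < size s)
    (hausdorff_const m * d ^+ m)%:E)%E).
  apply: lee_sum => j _; apply: hausdorff_gauge_le; first by rewrite lexx ltW.
  rewrite /F; case: ifP => // _ x y xb yb.
  apply: le_trans (ler_enorm_dist _ (nth 0 s j) _) _; move: xb yb; rewrite /eball/= => xb yb.
  by rewrite (enormB (nth _ _ _)); move: xb yb; rewrite /e; lra.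
rewrite sumEFin lee_fin sumr_const_nat subn0 -mulr_natr -mulrA ler_pM2l//.
have -> : d = 4 * e by rewrite /e; field.
rewrite exprMn -mulrA ler_pM2l ?exprn_gt0// mulrC.
exact: size_separated_esphere.
Qed.

(** Only the part of [A] on the unit sphere counts, so that the definition
applies to the arbitrary sets of a covering of the sphere. *)
Definition cone (A : set 'rV[R]_n) : set 'rV[R]_n :=
  [set x | exists t y, [/\ 0 <= t <= 1, A y, esphere 0 1 y & x = t *: y]].

(** Slicing the cone at heights [j / k] with [k] about [1 / e] gives pieces of
diameter at most [2 e], each inside a box of side [4 e]; there are at most
[3 / e] of them. *)
Lemma lebesgue_outer_cone_le_expr (A : set 'rV[R]_n) e : 0 < e <= 1 ->
  (forall x y, A x -> A y -> enorm (x - y) <= e) ->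
  (lebesgue_outer (cone A) <= (3 * 4 ^+ n * e ^+ m)%:E)%E.
Proof.
move=> /andP[e0 e1] Ae.
pose k := (Num.truncn e^-1).+1.
have ei0 : 0 < e^-1 by rewrite invr_gt0.
have /andP[k1 k2] := truncn_itv (ltW ei0).
have k0 : 0 < k%:R :> R by rewrite ltr0n.
have ke : k%:R^-1 <= e by rewrite invf_ple ?posrE// ltW.
pose P (j : nat) := [set x | exists t y, [/\ 0 <= t <= 1, A y, esphere 0 1 y,
  j%:R <= t * k%:R <= j.+1%:R & x = t *: y]].
have sub : cone A `<=` \big[setU/set0]_(j < k.+1) P j.
  move=> x [t [y [t01 Ay y1 ->]]]; have /andP[t0 t1] := t01.
  have tk0 : 0 <= t * k%:R by rewrite mulr_ge0.
  have /andP[j1 j2] := truncn_itv tk0.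
  rewrite -(bigcup_mkord _ P); exists (Num.truncn (t * k%:R)) => /=.
    by rewrite ltnS -(ler_nat R) (le_trans j1)// ler_piMl// ltW.
  by exists t, y; split => //; rewrite j1 ltW.
have Pj j : (lebesgue_outer (P j) <= ((4 * e) ^+ n)%:E)%E.
  have [->|/set0P[x0 Px0]] := eqVneq (P j) set0.
    rewrite (_ : lebesgue_outer set0 = 0%E); last exact: (outer_measure0 (@lebesgue_outer R n)).
    by rewrite lee_fin exprn_ge0// mulr_ge0// ltW.
  apply: (@le_trans _ _ (box_gauge (P j : set (coverable R n)))).
    by apply: mu_ext_le_gauge; [exact: box_gauge0|exact: box_gauge_ge0].
  apply: (le_trans (@box_gauge_le _ _ _ (x0 - const_mx (2 * e)) (x0 + const_mx (2 * e)) _ _)).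
  - by exists x0.
  - move=> x Px i; rewrite !mxE -ler_distlC.
    rewrite (_ : x0 0 i - x 0 i = (x0 - x) 0 i); last by rewrite !mxE.
    apply: le_trans (normr_coord_le_enorm _ _) _.
    have [t [y [/andP[t0 t1] Ay y1 /andP[jt tj] ->]]] := Px0.
    have [t' [y' [/andP[t'0 t'1] Ay' y'1 /andP[jt' tj'] ->]]] := Px.
    rewrite -(subrKA (t' *: y)) -scalerBl -scalerBr.
    apply: le_trans (ler_enormD _ _) _; rewrite !enormZ.
    move: y1; rewrite /esphere/= subr0 => ->; rewrite mulr1 (ger0_norm t'0) mulrDl mul1r.
    apply: lerD.
      apply: le_trans ke; rewrite -div1r ler_pdivlMr// -(gtr0_norm k0) -normrM mulrBl.
      by rewrite ler_norml; move: jt tj jt' tj'; rewrite -natr1; lra.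
    by rewrite -[e]mul1r ler_pM ?enorm_ge0//; exact: Ae.
  rewrite lee_fin le_eqVlt; apply/orP; left; apply/eqP.
  rewrite -[n in RHS]card_ord -prodr_const; apply: eq_bigr => i _.
  by rewrite !mxE; ring.
apply: (@le_trans _ _ (lebesgue_outer (\big[setU/set0]_(j < k.+1) P j))).
  exact: (le_outer_measure (@lebesgue_outer R n)).
apply: (@le_trans _ _ (\sum_(j < k.+1) lebesgue_outer (P j))%E).
  exact: (outer_measure_subadditive (@lebesgue_outer R n)).
apply: (@le_trans _ _ (\sum_(j < k.+1) ((4 * e) ^+ n)%:E)%E).
  by apply: lee_sum => j _; exact: Pj.
rewrite sumEFin lee_fin sumr_const card_ord -(mulr_natl _ k.+1) exprMn (exprS e).
have -> : k.+1%:R * (4 ^+ n * (e * e ^+ m)) = (k.+1%:R * e) * (4 ^+ n * e ^+ m) by ring.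
rewrite -[X in _ <= X]mulrA ler_wpM2r ?mulr_ge0 ?exprn_ge0 ?(ltW e0)//.
have : (Num.truncn e^-1)%:R * e <= 1 by rewrite -ler_pdivlMr// div1r.
by rewrite /k -natr1 -natr1; lra.
Qed.

(** The case of diameter [0] is obtained by letting the diameter bound tend to
[0], which uses [0 < m]. *)
Lemma lebesgue_outer_cone_le_gauge (E : set (coverable R n)) : (0 < m)%N ->
  (lebesgue_outer (cone E) <=
   (3 * 4 ^+ n / hausdorff_const m)%:E * hausdorff_gauge m 1 E)%E.
Proof.
move=> m0; have c0 := @hausdorff_const_gt0 R m.
have C0 : 0 < 3 * 4 ^+ n :> R by rewrite mulr_gt0 ?exprn_gt0.
have [->|/set0P E0] := eqVneq E set0.
  rewrite hausdorff_gauge0 mule0.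
  rewrite (_ : cone set0 = set0); last by rewrite -subset0 => x [t [y []]].
  by rewrite (_ : lebesgue_outer set0 = 0%E); last exact: (outer_measure0 (@lebesgue_outer R n)).
have [->|[d [/andP[d0 d1] Ed ->]]] := hausdorff_gaugeP m 1 E E0.
  by rewrite gt0_muley ?leey// lte_fin divr_gt0.
rewrite -EFinM mulrA divfK ?gt_eqF//.
move: d0; rewrite le_eqVlt => /predU1P[d0|d0]; last first.
  by apply: lebesgue_outer_cone_le_expr; rewrite ?d0.
rewrite -d0 expr0n eqn0Ngt m0/= mulr0; apply/lee_addgt0Pr => e e0; rewrite add0e.
pose a := Num.min 1 (e / (3 * 4 ^+ n)).
have a0 : 0 < a by rewrite lt_min ltr01 divr_gt0.
have a1 : a <= 1 by rewrite ge_min lexx.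
apply: le_trans (lebesgue_outer_cone_le_expr E a _ _) _.
- by rewrite a0.
- by move=> x y Ex Ey; apply: le_trans (Ed _ _ Ex Ey) _; rewrite -d0 ltW.
rewrite lee_fin mulrC -ler_pdivlMr//; apply: (@le_trans _ _ a).
  by rewrite -{2}(expr1 a) ler_wiXn2l// ltW.
by rewrite ge_min lexx orbT.
Qed.

(** The unit ball is the cone over the unit sphere, so its volume is at most a
multiple of the Hausdorff measure of the sphere. *)
Lemma hausdorff_unit_sphere_gt0 : (0 < m)%N -> 0 < @unit_ball_measure R n ->
  (0 < hausdorff m (esphere (0%R : 'rV[R]_n) 1))%E.
Proof.
move=> m0 w0; rewrite lt_neqAle hausdorff_ge0 andbT eq_sym; apply/eqP => S0.
have c0 := @hausdorff_const_gt0 R m.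
have C0 : 0 < 3 * 4 ^+ n / @hausdorff_const R m by rewrite divr_gt0// mulr_gt0 ?exprn_gt0.
have : (lebesgue_outer (cone (esphere 0 1)) <= 
   (3 * 4 ^+ n / hausdorff_const m)%:E * hausdorff_premeasure m 1 (esphere (0%R : 'rV[R]_n) 1))%E.
  apply: (@le_mu_ext_transport R n (@hausdorff_gauge R n m 1) _ _
      (@lebesgue_outer R n) cone).
  - exact: hausdorff_gauge_ge0.
  - exact: C0.
  - exact: outer_measure_ge0.
  - exact: outer_measure_sigma_subadditive.
  - exact: le_outer_measure.
  - by move=> X F XF x [t [y [t01 /XF[j _ Fy] y1 ->]]]; exists j => //; exists t, y.
  - by move=> E; exact: lebesgue_outer_cone_le_gauge.
have -> : hausdorff_premeasure m 1 (esphere (0%R : 'rV[R]_n) 1) = 0%E.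
  apply/eqP; rewrite eq_le -{1}S0 hausdorff_premeasure_le//=.
  exact/mu_ext_ge0/hausdorff_gauge_ge0.
rewrite mule0 => le0.
have : (leb R n (eball 0 1) <= 0)%E.
  apply: le_trans le0; apply: (le_outer_measure (@lebesgue_outer R n)).
  move=> x; rewrite /eball/= subr0 => x1.
  (* The origin lies on the cone through any unit vector. *)
  pose v : 'rV[R]_n := if x == 0 then const_mx 1 else x.
  have v0 : enorm v != 0.
    apply/eqP => /enorm_eq0; rewrite /v; case: ifPn => [_|/eqP//].
    by move/matrixP => /(_ 0 0); rewrite !mxE => /eqP; rewrite oner_eq0.
  have v1 : esphere 0 1 ((enorm v)^-1 *: v).
    by rewrite /esphere/= subr0 enormZ ger0_norm ?invr_ge0 ?enorm_ge0// mulVf.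
  exists (enorm x), ((enorm v)^-1 *: v); split => //.
    by rewrite enorm_ge0 ltW.
  move: v0; rewrite /v; have [-> _|_ v0] := eqVneq x 0; first by rewrite enorm0 scale0r.
  by rewrite scalerA divff// scale1r.
by rewrite leb_eball// expr1n mulr1 lee_fin leNgt w0.
Qed.

End unit_sphere.

(** * The essential boundary of a ball *)

Section essential_boundary_ball.
Context {R : realType} {m : nat}.
Local Notation n := m.+1.
Local Notation w := (@unit_ball_measure R n).
Hypothesis w0 : 0 < w.
Variables (p : 'rV[R]_n) (r : R).
Hypothesis r0 : 0 < r.
Implicit Types (x q : 'rV[R]_n) (s : R).

Let ratio x s :=
  fine (leb R n (eball p r `&` eball x s)) / fine (leb R n (eball x s)).

Let fine_leb_eball x s : 0 < s -> fine (leb R n (eball x s)) = w * s ^+ n.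
Proof. by move=> s0; rewrite leb_eball. Qed.

Let leb_capE x s : 0 < s ->
  leb R n (eball p r `&` eball x s) = (fine (leb R n (eball p r `&` eball x s)))%:E.
Proof.
move=> s0; rewrite fineK// ge0_fin_numE; last exact: measure_ge0.
apply: (@le_lt_trans _ _ (leb R n (eball x s))).
  by apply: (le_outer_measure (@lebesgue_outer R n)); exact: subIsetr.
by rewrite leb_eball// ltry.
Qed.

Let density_interior x : enorm (x - p) < r -> has_density 1 (eball p r) x.
Proof.
move=> xr; apply: cvg_near_cst; near=> s.
have s0 : 0 < s by near: s; exact: nbhs_right_gt.
have sr : s < r - enorm (x - p).
  by near: s; apply: nbhs_right_lt; rewrite subr_gt0.
rewrite setIidr; first by rewrite fine_leb_eball// divff// mulf_neq0 ?gt_eqF ?exprn_gt0.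
move=> y; rewrite /eball/= => ys; apply: le_lt_trans (ler_enorm_dist _ x _) _.
by rewrite -ltrBrDr (lt_trans ys).
Unshelve. all: by end_near. Qed.

Let density_exterior x : r < enorm (x - p) -> has_density 0 (eball p r) x.
Proof.
move=> xr; apply: cvg_near_cst; near=> s.
have sr : s < enorm (x - p) - r.
  by near: s; apply: nbhs_right_lt; rewrite subr_gt0.
rewrite (_ : _ `&` _ = set0).
  by rewrite (_ : leb R n set0 = 0%E) ?mul0r//; exact: measure0.
rewrite -subset0 => y []; rewrite /eball/= => yp yx.
have := ler_enorm_dist x y p; rewrite (enormB x y) leNgt => /negP; apply.
by rewrite -ltrBrDl in sr *; move: yp yx sr; lra.
Unshelve. all: by end_near. Qed.

Let ball_in x q s : 0 < s -> enorm (q - x) = s / 2 -> eball q (s / 2) `<=` eball x s.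
Proof.
move=> s0 qx y; rewrite /eball/= => yq; apply: le_lt_trans (ler_enorm_dist _ q _) _.
by rewrite qx {2}(splitr s) ltrD2r.
Qed.

(** For [x] on the sphere, the ball of radius [s / 2] tangent to the sphere at
[x] from inside lies both in the ball and in [eball x s]; the one tangent from
outside ([ratio_le]) avoids the ball.  Both have a fixed fraction [2 ^- n] of
the volume of [eball x s]. *)
Let ratio_ge x s : enorm (x - p) = r -> 0 < s < r -> (2 ^+ n)^-1 <= ratio x s.
Proof.
move=> xr /andP[s0 sr]; have s20 : 0 < s / 2 by rewrite divr_gt0.
pose q := x - (s / (2 * r)) *: (x - p).
have qx : enorm (q - x) = s / 2.
  rewrite /q addrAC subrr add0r enormN enormZ xr ger0_norm; last first.
    by rewrite divr_ge0 ?mulr_ge0 ?(ltW s0) ?(ltW r0).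
  by field; rewrite gt_eqF.
have qp : enorm (q - p) = r - s / 2.
  rewrite /q addrAC -[X in X - _]scale1r -scalerBl enormZ xr ger0_norm.
    by field; rewrite gt_eqF.
  by rewrite subr_ge0 ler_pdivrMr ?mulr_gt0//; lra.
rewrite /ratio fine_leb_eball// ler_pdivlMr ?mulr_gt0 ?exprn_gt0//.
rewrite -lee_fin -leb_capE//.
rewrite (_ : (_ * _)%:E = leb R n (eball q (s / 2))); last first.
  by rewrite leb_eball// expr_div_n; congr EFin; ring.
apply: (le_outer_measure (@lebesgue_outer R n)) => y yq; split; last exact: ball_in yq.
move: yq; rewrite /eball/= => yq; apply: le_lt_trans (ler_enorm_dist _ q _) _.
by rewrite qp; lra.
Qed.

Let ratio_le x s : enorm (x - p) = r -> 0 < s -> ratio x s <= 1 - (2 ^+ n)^-1.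
Proof.
move=> xr s0; have s20 : 0 < s / 2 by rewrite divr_gt0.
pose q := x + (s / (2 * r)) *: (x - p).
have qx : enorm (q - x) = s / 2.
  rewrite /q addrAC subrr add0r enormZ xr ger0_norm; last first.
    by rewrite divr_ge0 ?mulr_ge0 ?(ltW s0) ?(ltW r0).
  by field; rewrite gt_eqF.
have qp : enorm (q - p) = r + s / 2.
  rewrite /q addrAC -[X in X + _]scale1r -scalerDl enormZ xr ger0_norm.
    by field; rewrite gt_eqF.
  by rewrite addr_ge0// divr_ge0 ?mulr_ge0 ?(ltW s0) ?(ltW r0).
rewrite /ratio fine_leb_eball// ler_pdivrMr ?mulr_gt0 ?exprn_gt0//.
rewrite mulrBl mul1r lerBrDr -lee_fin EFinD -leb_capE//.
rewrite (_ : ((2 ^+ n)^-1 * _)%:E = leb R n (eball q (s / 2))); last first.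
  by rewrite leb_eball// expr_div_n; congr EFin; ring.
rewrite -(leb_eball x)//.
have -> : (leb R n (eball p r `&` eball x s) + leb R n (eball q (s / 2)) =
    leb R n ((eball p r `&` eball x s) `|` eball q (s / 2)))%E.
  apply/esym; apply: (measureU (leb R n)).
  - by apply: measurableI; exact: measurable_eball.
  - exact: measurable_eball.
  - rewrite -subset0 => y [[yp _] yq]; move: yp yq; rewrite /eball/= => yp yq.
    have := ler_enorm_dist q y p; rewrite qp (enormB q y); lra.
apply: (le_outer_measure (@lebesgue_outer R n)) => y [[_ //]|yq].
exact: ball_in yq.
Qed.

Lemma essential_boundary_eball : essential_boundary (eball p r) = esphere p r.
Proof.
have c0 : 0 < (2 ^+ n : R)^-1 by rewrite invr_gt0 exprn_gt0.
apply/seteqP; split=> x.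
  move=> [h0 h1]; rewrite /esphere/=; apply/eqP; rewrite eq_le !leNgt.
  by apply/andP; split; apply/negP; [move=> /density_exterior|move=> /density_interior].
rewrite /esphere/= => xr; split => h.
- have : (2 ^+ n : R)^-1 <= 0.
    apply: (cvgr_to_ge h); near=> s; apply: ratio_ge => //.
    apply/andP; split; first by near: s; exact: nbhs_right_gt.
    by near: s; exact: nbhs_right_lt.
  by rewrite leNgt c0.
- have : 1 <= 1 - (2 ^+ n : R)^-1.
    apply: (cvgr_to_le h); near=> s; apply: ratio_le => //.
  by rewrite lerBrDr gerDl leNgt c0.
Unshelve. all: by end_near. Qed.

End essential_boundary_ball.

(** * Functions with continuous partial derivatives *)

Section partial_derivatives.
Context {R : realType} {m : nat}.
Local Notation n := m.+1.
Variable psi : 'rV[R]_n -> R.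
Hypothesis dpsi : forall i x, derivable psi x (unit_vector i).
Hypothesis cpsi : forall i, continuous (fun x => 'D_(unit_vector i) psi x).

Let is_derive_line i x (s : R) :
  is_derive s 1 (fun t : R => psi (x + t *: unit_vector i))
    ('D_(unit_vector i) psi (x + s *: unit_vector i)).
Proof.
have E : (fun h : R => h^-1 *: (((fun t : R => psi (x + t *: unit_vector i)) \o shift s)
    (h *: (1 : R^o)) - psi (x + s *: unit_vector i))) =
  (fun h : R => h^-1 *: ((psi \o shift (x + s *: unit_vector i))
     (h *: unit_vector i) - psi (x + s *: unit_vector i))).
  apply/funext => h /=; congr (_ *: (psi _ - _)).
  by rewrite [h *: (1 : R^o)]mulr1 scalerDl addrCA.
apply: DeriveDef.
  by rewrite /derivable; rewrite E; exact: dpsi.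
by rewrite /derive; rewrite E.
Qed.

Lemma line_increment_le i x (t C : R) :
  (forall s, `|s| <= `|t| -> `|'D_(unit_vector i) psi (x + s *: unit_vector i)| <= C) ->
  `|psi (x + t *: unit_vector i) - psi x| <= C * `|t|.
Proof.
move=> HC; pose g (s : R) : R := psi (x + s *: unit_vector i).
have cg (A : set R) : {within A, continuous g}.
  apply: continuous_subspaceT => s; apply/differentiable_continuous/derivable1_diffP.
  by have [] := is_derive_line i x s.
have g0 : g 0 = psi x by rewrite /g scale0r addr0.
rewrite -/(g t) -g0; have [t0|/ltW t0] := leP 0 t.
- have [c] := MVT_segment t0 (fun s _ => is_derive_line i x s) (cg _).
  rewrite in_itv/= => /andP[c0 ct]; rewrite -/(g t) -/(g 0) => ->.
  rewrite subr0 normrM ler_wpM2r//; apply: HC.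
  by rewrite !ger0_norm// (le_trans c0).
- have [c] := MVT_segment t0 (fun s _ => is_derive_line i x s) (cg _).
  rewrite in_itv/= => /andP[ct c0]; rewrite -/(g t) -/(g 0) distrC => ->.
  rewrite sub0r normrM normrN ler_wpM2r//; apply: HC.
  by rewrite !ler0_norm// lerN2.
Qed.

(** Moving from [x] to [y] one coordinate at a time, each move changes [psi] by
at most a local bound of its partial derivatives times the displacement. *)
Lemma continuous_of_partials : continuous psi.
Proof.
move=> x.
have : \forall z \near x, forall i, `|'D_(unit_vector i) psi z| <= `|'D_(unit_vector i) psi x| + 1.
  apply: (@filter_forall _ _ (fun (i : 'I_n) (z : 'rV[R]_n) =>
    `|'D_(unit_vector i) psi z| <= `|'D_(unit_vector i) psi x| + 1) (nbhs x)
    (nbhs_filter x)) => i.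
  by apply: (@cvgr_norm_le _ _ _ _ _ _ _ (cpsi i x)); rewrite ltrDl.
move=> /nbhs_ballP[d /= d0 bd].
pose C := \sum_(i < n) (`|'D_(unit_vector i) psi x| + 1).
have C0 : 0 <= C by apply: sumr_ge0 => i _; rewrite addr_ge0.
have CC i z : ball x d z -> `|'D_(unit_vector i) psi z| <= C.
  move=> /bd /(_ i) /le_trans; apply; rewrite /C (bigD1 i)//= lerDl.
  by apply: sumr_ge0 => j _; rewrite addr_ge0.
apply/(@cvgrPdist_le _ _ _ (nbhs x) (nbhs_filter x)) => e e0.
pose de := Num.min d (e / (C * n%:R + 1)).
have Cn0 : 0 < C * n%:R + 1 by rewrite ltr_pwDr// mulr_ge0.
have de0 : 0 < de by rewrite lt_min d0 divr_gt0.
apply/nbhs_ballP; exists de => //= y [_ xy].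
have {}xy j : `|x 0 j - y 0 j| < de := xy 0 j.
(* The first [k] coordinates have been moved. *)
pose z k : 'rV[R]_n := \row_j (if (j < k)%N then y 0 j else x 0 j).
have z0 : z 0%N = x by apply/rowP => j; rewrite mxE.
have zn : z n = y by apply/rowP => j; rewrite mxE ltn_ord.
rewrite distrC; have -> : psi y - psi x = \sum_(0 <= k < n) (psi (z k.+1) - psi (z k)).
  by rewrite (telescope_sumr (fun k => psi (z k)))// zn z0.
apply: le_trans (ler_norm_sum _ _ _) _.
rewrite big_mkord; apply: (@le_trans _ _ (\sum_(k < n) C * de)).
  apply: ler_sum => k _.
  have -> : z k.+1 = z k + (y 0 k - x 0 k) *: unit_vector k.
    apply/rowP => j; rewrite !mxE eqxx/= ltnS.
    have [jk|jk|/val_inj ->] := ltngtP j k.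
    - by rewrite (_ : j == k = false) ?mulr0 ?addr0//; apply/negP => /eqP E; rewrite E ltnn in jk.
    - by rewrite (_ : j == k = false) ?mulr0 ?addr0//; apply/negP => /eqP E; rewrite E ltnn in jk.
    - by rewrite eqxx mulr1 addrC subrK.
  apply: (@le_trans _ _ (C * `|y 0 k - x 0 k|)); last first.
    by rewrite ler_wpM2l// distrC ltW.
  apply: line_increment_le => s sk; apply: CC; split => // a j.
  rewrite (ord1 a) /ball/= !mxE eqxx/=.
  have sd : `|s| < d.
    by apply: le_lt_trans sk _; rewrite distrC (lt_le_trans (xy k))// ge_min lexx.
  case: (ltnP j k) => jk.
    rewrite (_ : j == k = false) ?mulr0 ?addr0//; last first.
      by apply/negP => /eqP E; rewrite E ltnn in jk.
    by rewrite (lt_le_trans (xy j))// ge_min lexx.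
  rewrite opprD addrA subrr add0r normrN; case: (j == k); first by rewrite mulr1.
  by rewrite mulr0 normr0.
rewrite sumr_const card_ord -mulr_natr mulrAC.
apply: (@le_trans _ _ ((C * n%:R) * (e / (C * n%:R + 1)))).
  by rewrite ler_wpM2l ?mulr_ge0// ge_min lexx orbT.
rewrite mulrA ler_pdivrMr// mulrC ler_wpM2l ?(ltW e0)//.
by rewrite lerDl.
Qed.

End partial_derivatives.

(** * Balls have locally finite perimeter *)

Section ball_perimeter.
Context {R : realType} {m : nat}.
Local Notation n := m.+1.
Local Notation w := (@unit_ball_measure R n).
Variables (p : 'rV[R]_n) (r : R).
Hypothesis r0 : 0 < r.
Local Notation M := (eball p r).
Local Open Scope ereal_scope.

Let mM : measurable (M : set (lebesgueType R n)) := measurable_eball p r.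

Let leb_finite (q : 'rV[R]_n) s : leb R n (eball q s) < +oo.
Proof.
apply: (@le_lt_trans _ _ (leb R n (eball q (Num.max s 1%R)))).
  apply: (le_outer_measure (@lebesgue_outer R n)); apply: eball_sub.
  by rewrite le_max lexx.
by rewrite leb_eball ?ltry// lt_max ltr01 orbT.
Qed.

Lemma integral_translate (v : 'rV[R]_n) (u : lebesgueType R n -> \bar R) :
  measurable_fun [set: lebesgueType R n] u -> (forall x, 0 <= u x) ->
  \int[leb R n]_(x in M) u (dilation v 1%R x) =
  \int[leb R n]_(x in eball (v + p) r) u x.
Proof.
move=> mu u0.
have mv := @measurable_fun_dilation R n v 1 ltr01.
have preM : dilation v 1%R @^-1` eball (v + p) r = M.
  apply/seteqP; split=> x; rewrite /eball/dilation/= scale1r;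
    by rewrite opprD addrACA subrr add0r.
have := @ge0_integral_pushforward _ _ _ _ R _ mv (leb R n) (eball (v + p) r) u.
rewrite preM => <-//; last 2 first.
- exact: measurable_eball.
- exact: measurable_funTS.
apply: eq_measure_integral => A mA _.
have EA : dilation v 1%R @` (dilation v 1%R @^-1` A) = A.
  apply: image_preimage; apply/seteqP; split => // x _.
  by exists (x - v)%R => //; rewrite /dilation scale1r addrC subrK.
have E : forall B : set 'rV[R]_n, leb R n (dilation v 1%R @` B) = leb R n B.
  move=> B; have := @lebesgue_outer_dilation R n v 1 B ltr01.
  by rewrite expr1n mul1e.
suff : leb R n (dilation v 1%R @^-1` A) = leb R n A by [].
by rewrite -{2}EA E.
Qed.

(** The translated ball lies in the concentric ball of radius [r + t], and the
shell gained has volume of order [t]. *)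
Lemma integral_translate_le (v : 'rV[R]_n) (t : R) (u : lebesgueType R n -> R) :
  (enorm v <= t)%R -> measurable_fun [set: lebesgueType R n] u ->
  (forall x, (0 <= u x <= 2)%R) ->
  \int[leb R n]_(x in M) (u (dilation v 1%R x))%:E <=
  \int[leb R n]_(x in M) (u x)%:E +
    (2 * (w * (t * (n%:R * (r + t) ^+ m))))%:E.
Proof.
move=> vt mu u2.
have t0 : (0 <= t)%R := le_trans (enorm_ge0 _) vt.
have mEu D : measurable_fun D (fun x : lebesgueType R n => (u x)%:E).
  by apply/measurable_EFinP; exact: measurable_funTS.
have u0 x : 0 <= (u x)%:E by rewrite lee_fin; case/andP: (u2 x).
rewrite (integral_translate v (fun x => (u x)%:E)) => //.
apply: (@le_trans _ _ (\int[leb R n]_(x in eball p (r + t)) (u x)%:E)).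
  apply: ge0_subset_integral => //; [exact: measurable_eball|exact: measurable_eball|].
  move=> x; rewrite /eball/= => xr; apply: le_lt_trans (ler_enorm_dist _ (v + p)%R _) _.
  by rewrite addrK ltr_leD.
have sub : M `<=` eball p (r + t) by apply: eball_sub; rewrite lerDl.
have mA : measurable (eball p (r + t) `\` M : set (lebesgueType R n)).
  by apply: measurableD => //; exact: measurable_eball.
rewrite -[in leLHS](setDUK sub) ge0_integral_setU//; last by rewrite disj_set2E setDIK.
rewrite leeD2l//.
apply: (@le_trans _ _ (\int[leb R n]_(x in eball p (r + t) `\` M) (cst 2%:E) x)).
  apply: ge0_le_integral => //.
  by move=> x _; rewrite lee_fin; case/andP: (u2 x).
rewrite integral_cst// EFinM lee_pmul2l ?lte_fin//.
apply: (le_trans (leb_annulus_le p r (r + t)%R (r + t)%R _ _ _)) => //.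
  by rewrite lerDl.
by rewrite lee_fin addrAC subrr add0r.
Qed.

Local Close Scope ereal_scope.

Let bounded_integrable (h : lebesgueType R n -> R) (C : R) :
  measurable_fun [set: lebesgueType R n] h -> (forall x, M x -> `|h x| <= C) ->
  (leb R n).-integrable M (EFin \o h).
Proof.
move=> mh hC; apply: measurable_bounded_integrable => //.
- exact: leb_finite.
- exact: measurable_funTS.
- exists C; split; first exact: num_real.
  by move=> y Cy x Mx; apply: le_trans (hC x Mx) (ltW Cy).
Qed.

Section partial_integral.
Variable psi : 'rV[R]_n -> R.
Hypothesis dpsi : forall i x, derivable psi x (unit_vector i).
Hypothesis cpsi : forall i, continuous (fun x => 'D_(unit_vector i) psi x).
Hypothesis psi1 : forall x, `|psi x| <= 1.
Variable i : 'I_n.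

Let partial (x : 'rV[R]_n) : R := 'D_(unit_vector i) psi x.

Let partial_bound : exists C : R, forall z : 'rV[R]_n, (forall j, `|z 0 j - p 0 j| <= r + 1) ->
  `|partial z| <= C.
Proof.
pose K := [set z : 'rV[R]_n | forall j, `[p 0 j - (r + 1), p 0 j + (r + 1)]%classic (z 0 j)].
have cK : compact K.
  apply: (@rV_compact R _ (fun j => `[p 0 j - (r + 1), p 0 j + (r + 1)]%classic)) => j.
  exact: segment_compact.
have : compact (partial @` K).
  by apply: continuous_compact => //; apply: continuous_subspaceT; exact: cpsi.
move=> /compact_bounded[C [_ HC]]; exists (C + 1) => z zp.
apply: HC; first by rewrite ltrDl.
exists z => // j; rewrite /= in_itv/=; have := zp j; rewrite ler_norml.
by move=> /andP[h1 h2]; apply/andP; split; lra.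
Qed.

Let quotient (j : nat) (x : 'rV[R]_n) : R :=
  j.+1%:R * (psi (x + j.+1%:R^-1 *: unit_vector i) - psi x).

Let mpsi : measurable_fun [set: lebesgueType R n] (psi : lebesgueType R n -> R).
Proof. by apply: continuous_measurable_leb; exact: continuous_of_partials. Qed.

Let mpsi_shift (v : 'rV[R]_n) : measurable_fun [set: lebesgueType R n]
  (fun x : lebesgueType R n => psi ((x : 'rV[R]_n) + v)).
Proof.
rewrite (_ : (fun x => _) = (psi : lebesgueType R n -> R) \o
    (dilation v 1 : lebesgueType R n -> lebesgueType R n)).
  exact: measurableT_comp mpsi (measurable_fun_dilation v 1 ltr01).
by apply/funext => x; rewrite /dilation/= scale1r addrC.
Qed.

Let mquotient j : measurable_fun [set: lebesgueType R n]
  (quotient j : lebesgueType R n -> R).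
Proof.
exact: measurable_funM (measurable_cst _) (measurable_funB (mpsi_shift _) mpsi).
Qed.

Let quotient_bound C : (forall z : 'rV[R]_n, (forall j, `|z 0 j - p 0 j| <= r + 1) ->
  `|partial z| <= C) -> forall j x, M x -> `|quotient j x| <= C.
Proof.
move=> HC j x Mx; rewrite /quotient normrM ger0_norm// -ler_pdivlMl//.
rewrite mulrC; have {2}<- : `|j.+1%:R^-1| = j.+1%:R^-1 :> R by rewrite ger0_norm.
apply: line_increment_le => // s sj; apply: HC => l.
rewrite !mxE addrAC; apply: le_trans (ler_normD _ _) _; apply: lerD.
  apply: le_trans (ltW Mx); apply: le_trans (normr_coord_le_enorm _ l).
  by rewrite !mxE.
rewrite eqxx/= normrM; apply: (@le_trans _ _ `|s|).
  by rewrite ler_piMr//; case: (l == i); rewrite ?normr1 ?normr0.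
by apply: le_trans sj _; rewrite ger0_norm// invf_le1// ler1n.
Qed.

Let integral_quotient_le j :
  (\int[leb R n]_(x in M) (quotient j x)%:E <=
   (2 * (w * (n%:R * (r + 1) ^+ m)))%:E)%E.
Proof.
pose t : R := j.+1%:R^-1; pose v := t *: (unit_vector i : 'rV[R]_n).
have t0 : 0 < t by rewrite invr_gt0.
have t1 : t <= 1 by rewrite invf_le1// ler1n.
(* Adding [1] makes the integrand nonnegative and cancels in differences. *)
pose u (x : lebesgueType R n) : R := psi x + 1.
have mu : measurable_fun [set: lebesgueType R n] u by exact: measurable_funD.
have u2 x : 0 <= u x <= 2.
  have := psi1 x; rewrite ler_norml => /andP[h1 h2].
  by rewrite /u -lerBlDr sub0r h1/= -lerBrDr (le_trans h2)// lerBrDr.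
have vt : enorm v <= t by rewrite enormZ enorm_unit_vector mulr1 gtr0_norm.
have := integral_translate_le v t u vt mu u2.
have iu : (leb R n).-integrable M (EFin \o u).
  by apply: (bounded_integrable u 2 mu) => x _; rewrite ger0_norm; case/andP: (u2 x).
have muv : measurable_fun [set: lebesgueType R n]
    (fun x : lebesgueType R n => u (dilation v 1 x)).
  exact: measurableT_comp mu (measurable_fun_dilation v 1 ltr01).
have iuv : (leb R n).-integrable M (EFin \o (fun x => u (dilation v 1 x))).
  apply: (bounded_integrable (fun x => u (dilation v 1 x)) 2 muv) => x _.
  by rewrite ger0_norm; case/andP: (u2 (dilation v 1 x)).
have fin : (\int[leb R n]_(x in M) (u x)%:E \is a fin_num)%E.
  exact: integrable_fin_num iu.
rewrite -leeBlDl// -integralB_EFin// => H.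
have -> : (\int[leb R n]_(x in M) (quotient j x)%:E =
    (j.+1%:R)%:E * \int[leb R n]_(x in M) ((u (dilation v 1 x))%:E - (u x)%:E))%E.
  rewrite -integralZl//; last exact: (integrableB _ iuv iu).
  apply: eq_integral => x _; rewrite -EFinB -EFinM; congr EFin; congr (_ * _).
  by rewrite /u /dilation scale1r (addrC v) opprD addrACA subrr addr0.
rewrite -lee_pdivlMl//; apply: le_trans H _.
rewrite lee_fin -/t [leRHS]mulrCA ler_pM2l// [leRHS]mulrCA.
rewrite ler_wpM2l ?unit_ball_measure_ge0// ler_wpM2l ?(ltW t0)// ler_wpM2l//.
by apply: lerXn2r; rewrite ?nnegrE ?addr_ge0 ?(ltW r0) ?(ltW t0)// lerD2l.
Qed.

Lemma integrable_partial : (leb R n).-integrable M (EFin \o partial).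
Proof.
have [C HC] := partial_bound; apply: (bounded_integrable _ C).
  by apply: continuous_measurable_leb; exact: cpsi.
move=> x Mx; apply: HC => j; apply: (@le_trans _ _ r); last by rewrite lerDl.
apply: le_trans (ltW Mx); apply: le_trans (normr_coord_le_enorm _ j).
by rewrite !mxE.
Qed.

(** By dominated convergence, the partial derivative integrates to the limit of
the integrals of difference quotients; the shell estimate bounds these,
uniformly in [psi]. *)
Lemma integral_partial_le :
  (\int[leb R n]_(x in M) ('D_(unit_vector i) psi x)%:E <=
   (2 * (w * (n%:R * (r + 1) ^+ m)))%:E)%E.
Proof.
have [C HC] := partial_bound.
have mq j : measurable_fun (M : set (lebesgueType R n)) (fun x : lebesgueType R n => (quotient j x)%:E).
  by apply/measurable_EFinP; exact: measurable_funTS.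
have mp : measurable_fun (M : set (lebesgueType R n)) (fun x : lebesgueType R n => (partial x)%:E).
  by case/integrableP: integrable_partial.
have qp : {ae leb R n, forall x : lebesgueType R n, M x ->
    (quotient j x)%:E @[j --> \oo] --> (partial x)%:E}.
  apply: aeW => x _; apply: cvg_EFin; first exact: nearW.
  have H : (fun h : R => h^-1 *: ((psi \o shift x) (h *: unit_vector i) - psi x))
     @ 0^' --> partial x := dpsi i x.
  have -> : fine \o (fun j => (quotient j x)%:E) = (fun j : nat =>
      (j.+1%:R^-1)^-1 *: ((psi \o shift x) (j.+1%:R^-1 *: unit_vector i) - psi x)).
    by apply/funext => j; rewrite /quotient/= invrK [_ + x]addrC.
  apply: ((cvgr_dnbhsP _ _ _).1 H (fun j => j.+1%:R^-1)); split.
    by move=> j; rewrite invr_eq0 pnatr_eq0.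
  exact: cvg_harmonic.
have iC : (leb R n).-integrable M (EFin \o cst C).
  by apply: (bounded_integrable (cst C) `|C|).
have qC : {ae leb R n, forall (x : lebesgueType R n) j, M x -> (`|(quotient j x)%:E| <= (EFin \o cst C) x)%E}.
  by apply: aeW => x j Mx; rewrite lee_fin; exact: (quotient_bound C HC).
have [_ _ cvg] := dominated_convergence mM mq mp qp iC qC.
by apply: cvge_le cvg; apply: nearW => j; exact: integral_quotient_le.
Qed.

End partial_integral.

Lemma locally_finite_perimeter_eball : locally_finite_perimeter M.
Proof.
move=> K _; exists (n%:R * (2 * (w * (n%:R * (r + 1) ^+ m)))) => phi C1phi phi1 _.
pose psi (i : 'I_n) (x : 'rV[R]_n) : R := phi x 0 i.
have dpsi i j x : derivable (psi i) x (unit_vector j).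
  have [/(_ x) d _] := C1phi j; exact: (derivable_mxP _ _ _).1 d 0 i.
have Dpsi i j x : 'D_(unit_vector j) (psi i) x = ('D_(unit_vector j) phi x) 0 i.
  have [/(_ x) d _] := C1phi j; by rewrite (derive_mx d) mxE.
have cpsi i j : continuous (fun x => 'D_(unit_vector j) (psi i) x).
  rewrite (_ : (fun x => _) = (fun A : 'rV[R]_n => A 0 i) \o 'D_(unit_vector j) phi).
    have [_ cphi] := C1phi j.
    move=> x; apply: continuous_comp; first exact: cphi.
    exact: coord_continuous.
  by apply/funext => x; rewrite Dpsi.
have psi1 i x : `|psi i x| <= 1.
  exact: le_trans (normr_coord_le_enorm _ _) (phi1 x).
have -> : (\int[leb R n]_(x in M) (divergence phi x)%:E =
    \int[leb R n]_(x in M) \sum_(i < n) ('D_(unit_vector i) (psi i) x)%:E)%E.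
  apply: eq_integral => x _; rewrite sumEFin; congr EFin.
  by apply: eq_bigr => i _; rewrite Dpsi.
rewrite integral_sum//; last first.
  by move=> i; exact: (integrable_partial (psi i)).
apply: (@le_trans _ _ (\sum_(i < n) (2 * (w * (n%:R * (r + 1) ^+ m)))%:E)%E).
  by apply: lee_sum => i _; exact: integral_partial_le.
by rewrite sumEFin lee_fin sumr_const card_ord [leRHS]mulr_natl.
Qed.

End ball_perimeter.

(** * Log-convex decreasing profiles *)

Section log_convex_profile.
Context {R : realType}.
Variables (h : R -> R) (R0 : R).
Hypothesis R0_gt0 : 0 < R0.
Hypothesis h_gt0 : forall r, 0 <= r -> 0 < h r.
Hypothesis h_convex :
  convex_function (E := R^o) `[0, +oo[ (fun r => ln (h r)).
Hypothesis h_dec : forall r s, 0 < r -> r < s -> s < R0 -> h s < h r.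

Let l r := ln (h r).

Let l_convex (a b c : R) : 0 <= a -> a < b -> b < c ->
  (c - a) * l b <= (c - b) * l a + (b - a) * l c.
Proof.
move=> a0 ab bc; have ac : 0 < c - a by rewrite subr_gt0 (lt_trans ab).
pose t := (c - b) / (c - a).
have t0 : 0 <= t by rewrite divr_ge0// ?ltW// subr_gt0.
have t1 : t <= 1 by rewrite ler_pdivrMr// mul1r lerB// ltW.
have := @h_convex (Itv01 t0 t1) a c.
rewrite !inE/= !in_itv/= !andbT a0 (le_trans a0 (ltW (lt_trans ab bc))).
move=> /(_ isT isT) H; have {H} : l (t * a + (1 - t) * c) <= t * l a + (1 - t) * l c := H.
have -> : t * a + (1 - t) * c = b by rewrite /t; field; rewrite gt_eqF.
move=> /(ler_wpM2l (ltW ac)); rewrite mulrDr !mulrA => /le_trans; apply.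
rewrite le_eqVlt; apply/orP; left; apply/eqP; congr (_ * _ + _ * _).
  by rewrite /t; field; rewrite gt_eqF.
by rewrite /t; field; rewrite gt_eqF.
Qed.

Let l_dec r s : 0 < r -> r < s -> s < R0 -> l s < l r.
Proof.
move=> r0 rs sR; rewrite ltr_ln ?posrE ?h_gt0 ?h_dec// ltW//.
exact: lt_trans rs.
Qed.

Let l_lt0 s : 0 < s -> s < R0 -> l s < l 0.
Proof.
move=> s0 sR; have s20 : 0 < s / 2 by rewrite divr_gt0.
have ss : s / 2 < s by lra.
have := l_convex 0 (s / 2) s (lexx _) s20 ss.
have := l_dec _ _ s20 ss sR; rewrite !subr0 => H1 H2.
have : s * (2 * l (s / 2)) <= s * (l 0 + l s) by move: H2; lra.
by rewrite ler_pM2l//; lra.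
Qed.

(** The decrease on the open interval extends to the endpoint [0]: convexity at
[s / 2] between [0] and [s] puts [ln (h 0)] above [ln (h (s / 2))]. *)
Lemma profile_lt0 s : 0 < s -> s < R0 -> h s < h 0.
Proof.
by move=> s0 sR; rewrite -ltr_ln ?posrE ?h_gt0 ?l_lt0// ltW.
Qed.


(** With [l = ln h], convexity at [a] between [0] and [b] gives
[a (l a - l b) <= 2 rho (l 0 - l a)].  The choice [rho = R0 / 2 / (8 m.+1)]
turns this into [m.+1 (l a - l b) <= (l 0 - l a) / 2], so the logarithm of the
left-hand side is below that of [h 0 ^ m.+1 h b ^ m] by at least half of
[l 0 - l a]; [r0] is chosen so that replacing [h 0] by [h r] there costs less
than that. *)
Lemma profile_gap (m : nat) :
  (forall K, K < h 0 -> exists2 e, 0 < e & forall s, 0 < s < e -> K < h s) ->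
  exists rho r0 : R, [/\ 0 < rho <= R0 / 4, 0 < r0 < R0 &
    forall r, 0 < r < r0 ->
      h (R0 / 2 - rho) ^+ m.+1 * h 0 ^+ m < h r ^+ m.+1 * h (R0 / 2 + rho) ^+ m].
Proof.
move=> h_lsc; set c := R0 / 2; have c0 : 0 < c by rewrite divr_gt0.
pose N : R := m.+1%:R; have N0 : 0 < N by rewrite ltr0n.
have N1 : 1 <= N by rewrite ler1n.
pose rho := c / (8 * N); have rho0 : 0 < rho by rewrite divr_gt0 ?mulr_gt0.
have rhoE : rho * (8 * N) = c by rewrite /rho divfK// gt_eqF ?mulr_gt0.
have rhoc : rho * 8 <= c by rewrite -rhoE ler_pM2l// ler_peMr.
pose a := c - rho; pose b := c + rho.
have a0 : 0 < a by rewrite /a; lra.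
have ab : a < b by rewrite /a /b; lra.
have bR : b < R0 by rewrite /b /c; move: rhoc; rewrite /c; lra.
have aR : a < R0 := lt_trans ab bR.
have la : l a < l 0 := l_lt0 _ a0 aR.
have lab : N * (l a - l b) <= (l 0 - l a) / 2.
  have := l_convex 0 a b (lexx _) a0 ab; rewrite !subr0 => H.
  have H1 : a * (l a - l b) <= 2 * rho * (l 0 - l a) by move: H; rewrite /a /b; lra.
  have H2 : 4 * N * rho <= a by rewrite /a; lra.
  rewrite -(ler_pM2l rho0).
  have : rho * (4 * N) * (l a - l b) <= 2 * rho * (l 0 - l a).
    apply: le_trans H1; rewrite ler_wpM2r; [by []| |by rewrite mulrC].
    by rewrite subr_ge0 ltW// l_dec.
  by lra.
pose K := expR (l 0 - (l 0 - l a) / (2 * N)).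
have K0 : K < h 0.
  rewrite -[ltRHS]lnK ?posrE ?h_gt0// ltr_expR -/(l 0) gtrBl divr_gt0 ?mulr_gt0//.
  by rewrite subr_gt0.
have [e e0 he] := h_lsc K K0.
exists rho, (Num.min e (R0 / 2)); split.
- by rewrite rho0 -/c; move: rhoc; rewrite /c; lra.
- by rewrite lt_min e0 c0/= gt_min; apply/orP; right; lra.
move=> r /andP[r0]; rewrite lt_min => /andP[re rR].
have hr : K < h r by apply: he; rewrite r0.
have lr : l 0 - (l 0 - l a) / (2 * N) < l r.
  by rewrite -[ltLHS]expRK -/K ltr_ln ?posrE ?h_gt0 ?expR_gt0// ltW.
have hp s : 0 <= s -> 0 < h s by exact: h_gt0.
have b0 : 0 < b by exact: lt_trans ab.
rewrite -ltr_ln ?posrE ?mulr_gt0 ?exprn_gt0 ?hp ?(ltW r0) ?(ltW b0) ?(ltW a0)//.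
rewrite !lnM ?posrE ?exprn_gt0 ?hp ?(ltW r0) ?(ltW b0) ?(ltW a0)//.
rewrite !lnXn ?hp ?(ltW r0) ?(ltW b0) ?(ltW a0)// -/(l _) -/(l _).
rewrite -!(mulr_natl (ln _)) -!/(l _).
have Nm : m%:R = N - 1 :> R by rewrite /N -natr1 addrK.
have H : N * (l 0 - (l 0 - l a) / (2 * N)) < N * l r by rewrite ltr_pM2l.
have H' : N * (l 0 - (l 0 - l a) / (2 * N)) = N * l 0 - (l 0 - l a) / 2.
  by field; rewrite gt_eqF.
rewrite H' in H; rewrite Nm -/N -/a -/b.
have : l b < l a by exact: l_dec.
move: H lab; lra.
Qed.

End log_convex_profile.

(** * Weighted measure and perimeter of balls *)

(** The integral of a nonnegative function is a supremum over the simple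
functions below it, hence monotone without measurability; it is applied to the
weight on a sphere. *)
Lemma ge0_le_integral_nonmeasurable {d : measure_display} {T : measurableType d}
    {R : realType} (mu : {measure set T -> \bar R}) (D : set T)
    (f g : T -> \bar R) :
  (forall x, D x -> 0 <= f x)%E -> (forall x, D x -> f x <= g x)%E ->
  (\int[mu]_(x in D) f x <= \int[mu]_(x in D) g x)%E.
Proof.
move=> f0 fg; have g0 x : D x -> (0 <= g x)%E.
  by move=> Dx; apply: le_trans (f0 x Dx) (fg x Dx).
rewrite !ge0_integralE//; apply: ge_ereal_sup => _ [s /= sf <-].
apply: ereal_sup_ubound; exists s => //= x; apply: le_trans (sf x) _.
exact: lee_restrict.
Qed.

Section weighted_balls.
Context {R : realType} {m : nat}.
Local Notation n := m.+1.
Local Notation w := (@unit_ball_measure R n).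
Local Notation sigma := (hausdorff m (esphere (0 : 'rV[R]_n) 1)).
Variable g : 'rV[R]_n -> R.
Hypothesis g_gt0 : forall x, 0 < g x.
Hypothesis mg : measurable_fun [set: lebesgueType R n] (g : lebesgueType R n -> R).
Local Open Scope ereal_scope.

Let mEg (D : set (lebesgueType R n)) : measurable_fun D (fun x => (g x)%:E).
Proof. by apply/measurable_EFinP; exact: measurable_funTS. Qed.

Lemma weighted_measure_le (A : set 'rV[R]_n) (k : R) :
  measurable (A : set (lebesgueType R n)) -> (forall x, A x -> (g x <= k)%R) ->
  weighted_measure g A <= k%:E * leb R n A.
Proof.
move=> mA gk; rewrite -integral_cst//; apply: ge0_le_integral => //.
by move=> x _; rewrite lee_fin ltW.
Qed.

Lemma weighted_measure_ge (A : set 'rV[R]_n) (k : R) :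
  measurable (A : set (lebesgueType R n)) -> (0 <= k)%R ->
  (forall x, A x -> (k <= g x)%R) -> k%:E * leb R n A <= weighted_measure g A.
Proof. by move=> mA k0 gk; rewrite -integral_cst//; exact: ge0_le_integral. Qed.

Lemma weighted_measure_mono (A B : set 'rV[R]_n) :
  measurable (A : set (lebesgueType R n)) -> measurable (B : set (lebesgueType R n)) ->
  A `<=` B -> weighted_measure g A <= weighted_measure g B.
Proof.
move=> mA mB AB; apply: ge0_subset_integral => //.
by move=> x _; rewrite lee_fin ltW.
Qed.

Lemma weighted_perimeter_eball_le (p : 'rV[R]_n) (r k : R) : (0 < w)%R -> (0 < r)%R ->
  (forall x, esphere p r x -> (g x <= k)%R) ->
  weighted_perimeter g (eball p r) <= (k * r ^+ m)%:E * sigma.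
Proof.
move=> w0 r0 gk; rewrite /weighted_perimeter essential_boundary_eball//.
apply: le_trans (ge0_le_integral_nonmeasurable _ _ _ (cst k%:E) _ _) _.
- by move=> x _; rewrite lee_fin ltW.
- by move=> x /gk; rewrite lee_fin.
rewrite integral_cst; last exact: measurable_esphere.
suff : k%:E * hausdorff m (esphere p r) <= (k * r ^+ m)%:E * sigma by [].
by rewrite hausdorff_esphere// EFinM muleA.
Qed.

Lemma weighted_perimeter_eball_cst (p : 'rV[R]_n) (r k : R) : (0 < w)%R -> (0 < r)%R ->
  (forall x, esphere p r x -> g x = k) ->
  weighted_perimeter g (eball p r) = (k * r ^+ m)%:E * sigma.
Proof.
move=> w0 r0 gk; rewrite /weighted_perimeter essential_boundary_eball//.
rewrite (eq_integral (cst k%:E)); last by move=> x; rewrite inE => /gk ->.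
rewrite integral_cst; last exact: measurable_esphere.
suff : k%:E * hausdorff m (esphere p r) = (k * r ^+ m)%:E * sigma by [].
by rewrite hausdorff_esphere// EFinM muleA.
Qed.

Let leb_eball_ge0 (p : 'rV[R]_n) (r : R) : (0 <= r)%R ->
  leb R n (eball p r) = (w * r ^+ n)%:E.
Proof.
rewrite le_eqVlt => /predU1P[<-|/leb_eball//].
rewrite (_ : eball p 0 = set0); last first.
  by rewrite -subset0 => x; rewrite /eball/= ltNge enorm_ge0.
by rewrite expr0n mulr0; exact: (measure0 (leb R n)).
Qed.

(** The measure of the ball is a Lipschitz function of its radius, by the volume
of shells, and vanishes at radius [0]: the intermediate value theorem applies. *)
Lemma exists_eball_weighted_measure (p : 'rV[R]_n) (rho k : R) (d : R) :
  (0 <= rho)%R -> (forall x, eball p rho x -> (g x <= k)%R) ->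
  (0 < d)%R -> d%:E <= weighted_measure g (eball p rho) ->
  exists2 r, (0 < r <= rho)%R & weighted_measure g (eball p r) = d%:E.
Proof.
move=> rho0 gk d0 dle.
have k0 : (0 <= k)%R.
  have [rho00|] := eqVneq rho 0%R; last first.
    move=> rhon0; apply: le_trans (ltW (g_gt0 p)) (gk p _).
    by rewrite /eball/= subrr enorm0 lt_neqAle eq_sym rhon0.
  move: dle; rewrite rho00 (_ : eball p 0 = set0); last first.
    by rewrite -subset0 => x; rewrite /eball/= ltNge enorm_ge0.
  by rewrite /weighted_measure integral_set0 lee_fin leNgt d0.
have wmE r : (0 <= r <= rho)%R ->
    weighted_measure g (eball p r) = (fine (weighted_measure g (eball p r)))%:E.
  move=> /andP[r0 rr]; rewrite fineK// ge0_fin_numE; last first.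
    by apply: integral_ge0 => x _; rewrite lee_fin ltW.
  apply: le_lt_trans (weighted_measure_le _ k (measurable_eball p r) _) _.
    by move=> x xr; apply: gk; exact: eball_sub xr.
  by rewrite leb_eball_ge0// -EFinM ltry.
pose F r := fine (weighted_measure g (eball p r)).
pose L : R := (k * (w * (n%:R * rho ^+ m)))%R.
have L0 : (0 <= L)%R.
  by rewrite !mulr_ge0 ?unit_ball_measure_ge0 ?exprn_ge0.
have F_lip r s : (0 <= r)%R -> (r <= s)%R -> (s <= rho)%R ->
    (0 <= F s - F r <= L * (s - r))%R.
  move=> r0 rs sr; have s0 := le_trans r0 rs.
  have sub : eball p r `<=` eball p s by exact: eball_sub.
  have mA : measurable (eball p s `\` eball p r : set (lebesgueType R n)).
    by apply: measurableD; exact: measurable_eball.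
  have E : weighted_measure g (eball p s) = weighted_measure g (eball p r) +
      weighted_measure g (eball p s `\` eball p r).
    rewrite /weighted_measure -{1}(setDUK sub) ge0_integral_setU//.
    - exact: measurable_eball.
    - by move=> x _; rewrite lee_fin ltW.
    - by rewrite disj_set2E setDIK.
  have A0 : 0 <= weighted_measure g (eball p s `\` eball p r).
    by apply: integral_ge0 => x _; rewrite lee_fin ltW.
  have AL : weighted_measure g (eball p s `\` eball p r) <= (L * (s - r))%:E.
    apply: le_trans (weighted_measure_le _ k mA _) _.
      by move=> x [xs _]; apply: gk; exact: eball_sub xs.
    have -> : leb R n (eball p s `\` eball p r) = (w * (s ^+ n - r ^+ n))%:E.
      rewrite mulrBr EFinB -(leb_eball_ge0 p s s0) -(leb_eball_ge0 p r r0) -[in RHS](setIidr sub).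
      apply: (measureD (mu := leb R n)); [exact: measurable_eball|exact: measurable_eball|].
      by suff : leb R n (eball p s) < +oo by []; rewrite leb_eball_ge0// ltry.
    rewrite -EFinM lee_fin /L -!mulrA ler_wpM2l// ler_wpM2l ?unit_ball_measure_ge0//.
    by rewrite [leRHS]mulrA [leRHS]mulrC subrX_le.
  move: E A0 AL; rewrite wmE ?s0// [weighted_measure g (eball p r)]wmE ?r0 ?(le_trans rs)// -/(F s) -/(F r).
  case: (weighted_measure g (eball p s `\` eball p r)) => [a| |]//=.
  by rewrite -EFinD => -[-> ]; rewrite !lee_fin addrAC subrr add0r => -> ->.
(* Clamping the radius to [0, rho] gives a function continuous on the whole line. *)
pose cl x : R := Num.min (Num.max x 0%R) rho.
have clge x : (0 <= cl x)%R by rewrite le_min le_max lexx orbT.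
have clle x : (cl x <= rho)%R by rewrite ge_min lexx orbT.
have cl_lip x y : (x <= y)%R -> (cl x <= cl y)%R /\ (cl y - cl x <= y - x)%R.
  move=> xy; split; first by rewrite /cl le_min2 ?le_max2.
  have t0 : (0 <= y - x)%R by rewrite subr_ge0.
  rewrite lerBlDr /cl addr_minr addr_maxr subrK.
  by rewrite le_min2 ?le_max2 ?lerDr// addr0.
have cF : continuous (F \o cl).
  have lip x y : (x <= y)%R -> (`|F (cl y) - F (cl x)| <= L * (y - x))%R.
    move=> xy; have [c1 c2] := cl_lip x y xy.
    have /andP[H1 H2] := F_lip (cl x) (cl y) (clge x) c1 (clle y).
    by rewrite ger0_norm//; apply: le_trans H2 _; rewrite ler_wpM2l.
  have L1 : (0 < L + 1)%R by rewrite ltr_wpDl.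
  move=> x; apply/cvgrPdist_le => e e0; near=> y.
  have xy : (`|x - y| <= e / (L + 1))%R.
    by near: y; apply: cvgr_dist_le; [exact: cvg_id|exact: divr_gt0].
  have H : (`|F (cl x) - F (cl y)| <= L * `|x - y|)%R.
    have [yx|/ltW xy'] := leP y x.
      by rewrite [in leRHS]ger0_norm ?subr_ge0// lip.
    by rewrite distrC [in leRHS]distrC [in leRHS]ger0_norm ?subr_ge0// lip.
  apply: le_trans H _; apply: le_trans (ler_wpM2l L0 xy) _.
  by rewrite mulrA ler_pdivrMr// mulrC ler_wpM2l ?(ltW e0)// lerDl.
have F0 : F 0%R = 0%R.
  rewrite /F (_ : eball p 0 = set0) /weighted_measure ?integral_set0//.
  by rewrite -subset0 => x; rewrite /eball/= ltNge enorm_ge0.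
have cl0 : cl 0%R = 0%R by rewrite /cl maxxx; apply/min_idPl.
have clrho : cl rho = rho by rewrite /cl; apply/min_idPr; rewrite le_max lexx.
have dF : (d <= F rho)%R by rewrite -lee_fin -wmE// rho0 lexx.
have [|r] := @IVT R (F \o cl) 0%R rho d rho0 (continuous_subspaceT cF).
  rewrite /= cl0 clrho F0 min_l; last by rewrite (le_trans (ltW d0)).
  by rewrite max_r ?(le_trans (ltW d0))// dF ltW.
rewrite in_itv/= => /andP[r0 rrho] Fr.
have clr : cl r = r.
  by rewrite /cl (_ : Num.max r 0%R = r); [exact/min_idPl|exact/max_idPl].
move: Fr; rewrite clr => Fr; exists r.
  rewrite rrho andbT lt_neqAle r0 andbT eq_sym; apply/eqP => r00.
  by move: d0; rewrite -Fr r00 F0 ltxx.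
by rewrite wmE ?r0// -/(F r) Fr.
Unshelve. all: by end_near. Qed.

End weighted_balls.

(** * Balls centred at the origin are not isoperimetric *)

Lemma radial_lower_semicontinuous_at0 {R : realType} {m : nat}
    (f : 'rV[R]_m.+1 -> R) (h : R -> R) (K : R) :
  lower_semicontinuous (EFin \o f) -> (forall x, f x = h (enorm x)) -> K < h 0 ->
  exists2 e, 0 < e & forall s, 0 < s < e -> K < h s.
Proof.
move=> flsc fh Kh.
have [|V V0 KV] := flsc 0 K; first by rewrite lte_fin fh enorm0.
have /nbhs_ballP[e /= e0 eV] := V0; exists e => // s /andP[s0 se].
pose y : 'rV[R]_m.+1 := s *: unit_vector 0.
have ys : enorm y = s by rewrite enormZ enorm_unit_vector mulr1 gtr0_norm.
rewrite -ys -fh -lte_fin; apply: KV; apply: eV; split => // i j.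
rewrite /ball/= !mxE sub0r normrN normrM gtr0_norm//; apply: le_lt_trans se.
by rewrite ler_piMr ?(ltW s0)//; case: (_ && _); rewrite ?normr1 ?normr0.
Qed.

Section off_center_ball.
Context {R : realType} {m : nat}.
Local Notation n := m.+1.
Local Notation w := (@unit_ball_measure R n).
Local Notation sigma := (hausdorff m (esphere (0 : 'rV[R]_n) 1)).
Variables (g : 'rV[R]_n -> R) (h : R -> R) (R0 : R).
Hypothesis m_gt0 : (0 < m)%N.
Hypothesis w_gt0 : 0 < w.
Hypothesis g_gt0 : forall x, 0 < g x.
Hypothesis mg : measurable_fun [set: lebesgueType R n] (g : lebesgueType R n -> R).
Hypothesis gh : forall x, g x = h (enorm x).
Hypothesis R0_gt0 : 0 < R0.
Hypothesis h_gt0 : forall r, 0 <= r -> 0 < h r.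
Hypothesis h_dec : forall r s, 0 < r -> r < s -> s < R0 -> h s < h r.
Hypothesis h_lt0 : forall s, 0 < s -> s < R0 -> h s < h 0.

Let h_anti r s : 0 < r -> r <= s -> s < R0 -> h s <= h r.
Proof.
move=> r0; rewrite le_eqVlt => /predU1P[->//|rs] sR.
by rewrite ltW// h_dec.
Qed.

Let g_le0 x : enorm x < R0 -> g x <= h 0.
Proof.
rewrite gh; have := enorm_ge0 x; rewrite le_eqVlt => /predU1P[<-//|x0 xR].
by rewrite ltW// h_lt0.
Qed.

Lemma weighted_measure_centered_ge (r s : R) : 0 < r -> r <= s -> r < R0 ->
  ((h r * (w * r ^+ n))%:E <= weighted_measure g (eball 0 s))%E.
Proof.
move=> r0 rs rR; apply: (@le_trans _ _ (weighted_measure g (eball 0 r))); last first.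
  apply: weighted_measure_mono => //; [exact: measurable_eball|exact: measurable_eball|].
  exact: eball_sub.
rewrite EFinM -(leb_eball 0 r r0); apply: weighted_measure_ge => //.
- exact: measurable_eball.
- by rewrite ltW// h_gt0// ltW.
move=> x; rewrite /eball/= subr0 gh => xr.
have := enorm_ge0 x; rewrite le_eqVlt => /predU1P[<-|x0]; first by rewrite ltW// h_lt0.
by apply: h_anti => //; exact: ltW.
Qed.

(** Competing with the ball of the same measure [d] centred at a point of norm
[R0 / 2]: comparing both measures and both perimeters and eliminating the two
radii contradicts the gap inequality. *)
Lemma centered_eball_not_isoperimetric (rho r d : R) : 0 < rho <= R0 / 4 -> 0 < r < R0 ->
  h (R0 / 2 - rho) ^+ n * h 0 ^+ m < h r ^+ n * h (R0 / 2 + rho) ^+ m ->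
  0 < d <= h (R0 / 2 + rho) * (w * rho ^+ n) ->
  weighted_measure g (eball 0 r) = d%:E ->
  ~ isoperimetric g g d (eball 0 r).
Proof.
move=> /andP[rho0 rhoR] /andP[r0 rR] gap /andP[d0 dle] wd [_ iso].
set a := R0 / 2 - rho in gap *; set b := R0 / 2 + rho in gap dle *.
have a0 : 0 < a by rewrite /a; lra.
have ab : a < b by rewrite /a /b; lra.
have bR : b < R0 by rewrite /b; lra.
have b0 : 0 < b := lt_trans a0 ab.
pose x0 : 'rV[R]_n := (R0 / 2) *: unit_vector 0.
have x0E : enorm x0 = R0 / 2.
  by rewrite enormZ enorm_unit_vector mulr1 gtr0_norm// divr_gt0.
have near_x0 y s : s <= rho -> enorm (y - x0) <= s -> h b <= g y <= h a.
  move=> sr ys; have := ler_dist_enorm y x0; rewrite x0E ler_norml => /andP[y1 y2].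
  have ay : a <= enorm y by rewrite /a; lra.
  have yb : enorm y <= b by rewrite /b; lra.
  rewrite gh; apply/andP; split; apply: h_anti => //.
  - exact: lt_le_trans a0 ay.
  - exact: le_lt_trans yb bR.
have hb0 : 0 < h b by rewrite h_gt0// ltW.
have ha0 : 0 < h a by rewrite h_gt0// ltW.
have h00 : 0 < h 0 by exact: h_gt0.
have hr0 : 0 < h r by rewrite h_gt0// ltW.
have [s /andP[s0 srho] ws] : exists2 s, 0 < s <= rho &
    weighted_measure g (eball x0 s) = d%:E.
  apply: (@exists_eball_weighted_measure _ _ g g_gt0 mg x0 rho (h a)) => //.
  - exact: ltW.
  - by move=> y /ltW yx; have /andP[] := near_x0 y rho (lexx _) yx.
  apply: (@le_trans _ _ ((h b)%:E * leb R n (eball x0 rho))%E).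
    by rewrite leb_eball// -EFinM lee_fin.
  apply: weighted_measure_ge => //; [exact: measurable_eball|exact: ltW|].
  by move=> y /ltW yx; have /andP[] := near_x0 y rho (lexx _) yx.
have comp : competitor g d (eball x0 s).
  split => //; first exact: measurable_eball.
  exact: locally_finite_perimeter_eball.
have := iso _ comp.
rewrite (weighted_perimeter_eball_cst g 0 r (h r) w_gt0 r0); last first.
  by move=> x; rewrite /esphere/= subr0 gh => ->.
move=> /le_trans /(_ (weighted_perimeter_eball_le g g_gt0 x0 s (h a) w_gt0 s0 _)).
have sig0 : (0 < sigma)%E by exact: hausdorff_unit_sphere_gt0.
have sigfin : (sigma < +oo)%E by exact: hausdorff_unit_sphere_fin.
have sigE : sigma \is a fin_num by rewrite ge0_fin_numE// hausdorff_ge0.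
have near_s x : esphere x0 s x -> g x <= h a.
  by move=> xs; have /andP[] := near_x0 x s srho (eq_ind_r (fun t => t <= s) (lexx s) xs).
move=> /(_ near_s); rewrite lee_pmul2r// lee_fin => per.
have vol1 : h b * (w * s ^+ n) <= d.
  rewrite -lee_fin -ws EFinM -(leb_eball x0 s s0).
  apply: weighted_measure_ge => //; [exact: measurable_eball|exact: ltW|].
  by move=> y /ltW yx; have /andP[] := near_x0 y s srho yx.
have vol2 : d <= h 0 * (w * r ^+ n).
  rewrite -lee_fin -wd EFinM -(leb_eball 0 r r0).
  apply: weighted_measure_le => //; first exact: measurable_eball.
  by move=> y; rewrite /eball/= subr0 => yr; apply: g_le0; exact: lt_trans yr rR.
have vol : h b * s ^+ n <= h 0 * r ^+ n.
  have := le_trans vol1 vol2.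
  by rewrite mulrCA [leRHS]mulrCA ler_pM2l.
have perN : (h r * r ^+ m) ^+ n <= (h a * s ^+ m) ^+ n.
  by apply: lerXn2r => //; rewrite nnegrE mulr_ge0 ?exprn_ge0 ?ltW.
have volm : (h b * s ^+ n) ^+ m <= (h 0 * r ^+ n) ^+ m.
  by apply: lerXn2r => //; rewrite nnegrE mulr_ge0 ?exprn_ge0 ?ltW.
have : (h r * r ^+ m) ^+ n * (h b * s ^+ n) ^+ m <=
    (h a * s ^+ m) ^+ n * (h 0 * r ^+ n) ^+ m.
  by apply: ler_pM => //; rewrite exprn_ge0// mulr_ge0 ?exprn_ge0 ?ltW.
rewrite !exprMn -!exprM [(n * m)%N]mulnC => H.
pose q := r ^+ (m * n) * s ^+ (m * n).
have q0 : 0 < q by rewrite mulr_gt0 ?exprn_gt0.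
move: gap; rewrite -(ltr_pM2r q0) ltNge => /negP; apply.
by move: H; rewrite mulrACA [leRHS]mulrACA [s ^+ _ * _]mulrC.
Qed.

End off_center_ball.

(* [d0] depends on [N], on [R0] and on the values [h0] of the weight on
   [0, R0), and on nothing else. *)
Theorem lemma5p1 (R : realType) (N : nat) (hN : (2 <= N)%N)
    (R0 : R) (hR0 : 0 < R0) (h0 : R -> R) :
  exists2 d0 : R, 0 < d0 &
    forall (f g : 'rV[R]_N -> R) (h : R -> R),
      (forall x, 0 < f x) -> (forall x, 0 < g x) ->
      locally_integrable_on_RN g ->
      lower_semicontinuous (EFin \o f) ->
      (forall r, 0 <= r -> 0 < h r) ->
      (forall x, f x = h (enorm x) /\ g x = h (enorm x)) ->
      convex_function (E := R^o) `[0, +oo[ (fun r => ln (h r)) ->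
      (forall r s, 0 < r -> r < s -> s < R0 -> h s < h r) ->
      (forall r, 0 <= r -> r < R0 -> h r = h0 r) ->
      forall d : R, 0 < d <= d0 ->
      forall r : R, 0 < r -> weighted_measure g (eball 0 r) = d%:E ->
        ~ isoperimetric f g d (eball 0 r).
Proof.
case: N hN => [//|m] hN; have m0 : (0 < m)%N by [].
pose w : R := @unit_ball_measure R m.+1.
have w_ge0 : 0 <= w by exact: unit_ball_measure_ge0.
(* The constants are extracted from [h0] alone, as [d0] must not depend on [h].
   When they do not exist, or when [w] vanishes, no admissible weight has a
   centred ball of positive measure, and any [d0] will do. *)
pose gap rho r0 := [/\ 0 < rho <= R0 / 4, 0 < r0 < R0 & forall r, 0 < r < r0 ->
  h0 (R0 / 2 - rho) ^+ m.+1 * h0 0 ^+ m < h0 r ^+ m.+1 * h0 (R0 / 2 + rho) ^+ m].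
pose positive := forall r, 0 <= r -> r < R0 -> 0 < h0 r.
have [[wpos [h0_gt0 [rho [r0 [rho_itv r0_itv h0gap]]]]]|nogap] :=
  pselect (0 < w /\ positive /\ exists rho r0, gap rho r0); last first.
  exists 1 => // f g h f_gt0 g_gt0 [mg _] flsc h_gt0 fgh hconv hdec hh0 d /andP[d0 _].
  move=> r r0 wd _; apply: nogap; split; [|split].
  - rewrite lt_neqAle w_ge0 andbT eq_sym; apply/eqP => w0.
    have : (weighted_measure g (eball 0 r) = 0)%E.
      apply: null_set_integral; [exact: measurable_eball| |].
        by apply/measurable_EFinP; exact: measurable_funTS.
      suff : leb R m.+1 (eball 0 r) = 0%E by [].
      by rewrite leb_eball// -/w w0 mul0r.
    by rewrite wd => -[d00]; move: d0; rewrite d00 ltxx.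
  - by move=> s s0 sR; rewrite -hh0// h_gt0.
  have fh x : f x = h (enorm x) by case: (fgh x).
  have [rho [s0 [rho_itv s0_itv hgap]]] := profile_gap h R0 hR0 h_gt0 hconv hdec m
    (fun K Kh => radial_lower_semicontinuous_at0 f h K flsc fh Kh).
  exists rho, s0; split => // s s_itv.
  have /andP[rho1 rho2] := rho_itv; have /andP[s01 s02] := s0_itv.
  have /andP[s1 s2] := s_itv.
  rewrite -(hh0 (R0 / 2 - rho)); [|lra|lra].
  rewrite -(hh0 (R0 / 2 + rho)); [|lra|lra].
  rewrite -(hh0 s (ltW s1) (lt_trans s2 s02)) -(hh0 0 (lexx _) hR0).
  exact: hgap.
have /andP[r0pos r0R] := r0_itv; have /andP[rho0 rhoR] := rho_itv.
have r1pos : 0 < r0 / 2 by rewrite divr_gt0.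
have r1R : r0 / 2 < R0 by lra.
have b0 : 0 <= R0 / 2 + rho by lra.
have bR : R0 / 2 + rho < R0 by lra.
pose X := h0 (R0 / 2 + rho) * (w * rho ^+ m.+1).
pose Y := h0 (r0 / 2) * (w * (r0 / 2) ^+ m.+1).
have Y0 : 0 < Y by rewrite !mulr_gt0 ?exprn_gt0// h0_gt0// ltW.
exists (Num.min X (Y / 2)).
  by rewrite lt_min divr_gt0// andbT !mulr_gt0 ?exprn_gt0// h0_gt0.
move=> f g h f_gt0 g_gt0 [mg _] flsc h_gt0 fgh hconv hdec hh0 d /andP[d0].
rewrite le_min => /andP[dX dY].
have fg : f = g by apply/funext => x; case: (fgh x) => -> ->.
have gh x : g x = h (enorm x) by case: (fgh x).
have h_lt0 := profile_lt0 h R0 h_gt0 hconv hdec.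
rewrite fg => r r_gt0 wd.
have rr0 : r < r0.
  rewrite ltNge; apply/negP => r0r; have r1r : r0 / 2 <= r by lra.
  have := weighted_measure_centered_ge g h R0 g_gt0 mg gh h_gt0 hdec h_lt0
    (r0 / 2) r r1pos r1r r1R.
  rewrite wd lee_fin hh0 ?(ltW r1pos)// -/w -/Y leNgt => /negP; apply.
  by apply: le_lt_trans dY _; rewrite ltr_pdivrMr// ltr_pMr// ltr1n.
apply: (@centered_eball_not_isoperimetric _ _ g h R0 m0 wpos g_gt0 mg gh hR0 h_gt0
  hdec h_lt0 rho r d) => //.
- by rewrite r_gt0 (lt_trans rr0).
- rewrite (hh0 (R0 / 2 - rho)); [|lra|lra].
  rewrite (hh0 (R0 / 2 + rho))// (hh0 r (ltW r_gt0) (lt_trans rr0 r0R)) (hh0 0 (lexx _) hR0).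
  by apply: h0gap; rewrite r_gt0.
- by rewrite d0 hh0.
Qed.
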